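(* Every positroid has expected codimension: if $P$ is a positroid of rank $k$ on $[n]$, then the codimension of the matroid variety $X(P)$ in the Grassmannian $G(k,n)$ equals $\mathrm{ec}(P)$.
   Context: For a matroid $M$ of rank $k$ on $[n]$, $X^\circ(M)\subseteq G(k,n)$ is the set of points (row spans of full-rank $k\times n$ matrices) whose column matroid is $M$, i.e. whose nonvanishing Plücker coordinates are exactly those indexed by bases of $M$; $X(M)$ is its closure. A positroid of rank $k$ on $[n]$ is the matroid of a real point of $G(k,n)$ all of whose Plücker coordinates are nonnegative (equivalently, a matroid generated by rank conditions on cyclic intervals). Expected codimension: for $\mathfrak{S}\subseteq\mathcal{P}([n])$ and $S\in\mathfrak{S}$ set $c(S)=\#S-\mathrm{rk}\,S$ and define recursively $a_{\mathfrak{S}}(S)=c(S)-\sum_{T\in\mathfrak{S},\,T\subsetneq S}a_{\mathfrak{S}}(T)$, with $a_{\mathfrak{S}}(\varnothing)=0$; put $\mathrm{ec}_{\mathfrak{S}}(M)=\sum_{S\in\mathfrak{S}}(k-\mathrm{rk}\,S)\,a_{\mathfrak{S}}(S)$ and $\mathrm{ec}(M)=\mathrm{ec}_{\mathcal{P}([n])}(M)$. *)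

(* Defs.v *)
From HB Require Import structures.
From mathcomp Require Import all_boot all_order all_algebra.
From mathcomp Require Import reals.
From mathcomp Require Import complex.
From mathcomp Require mpoly.

Set Implicit Arguments.
Unset Strict Implicit.
Unset Printing Implicit Defensive.

Import Order.TTheory GRing.Theory Num.Theory.
Local Open Scope ring_scope.

Section Zariski.
Variables (K : fieldType) (I : finType).

Definition pt := I -> K.
Definition polyI := mpoly.mpoly #|I| K.

Definition peval (p : polyI) (x : pt) : K :=
  mpoly.meval (fun j : 'I_#|I| => x (enum_val j)) p.

Definition zero_set (F : polyI -> Prop) : pt -> Prop :=
  fun x => forall p, F p -> peval p x = 0.

Definition zclosed (Z : pt -> Prop) : Prop :=
  exists F, forall x, Z x <-> zero_set F x.

Definition psubset (A B : pt -> Prop) := forall x, A x -> B x.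

Definition zclosure (S : pt -> Prop) : pt -> Prop :=
  fun x => forall Z, zclosed Z -> psubset S Z -> Z x.

Definition zirreducible (Z : pt -> Prop) : Prop :=
  [/\ zclosed Z, exists x, Z x &
      forall Z1 Z2, zclosed Z1 -> zclosed Z2 ->
        psubset Z (fun x => Z1 x \/ Z2 x) -> psubset Z Z1 \/ psubset Z Z2].

Definition irr_chain (Y : pt -> Prop) (d : nat) (Z : nat -> pt -> Prop) :=
  [/\ forall i, (i <= d)%N -> zirreducible (Z i),
      forall i, (i < d)%N -> psubset (Z i) (Z i.+1) /\ ~ psubset (Z i.+1) (Z i)
    & psubset (Z d) Y].

Definition krull_dim (Y : pt -> Prop) (d : nat) : Prop :=
  (exists Z, irr_chain Y d Z) /\ (forall d' Z, irr_chain Y d' Z -> (d' <= d)%N).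

End Zariski.

(* the maximal minor of A on the column set S (columns in increasing
   order); by convention 0 if #|S| <> k *)
Definition minor (F : comNzRingType) (k n : nat) (A : 'M[F]_(k, n))
    (S : {set 'I_n}) : F :=
  if #|S| == k then
    \det (\matrix_(i < k, j < k) nth 0 [seq A i c | c <- enum S] j)
  else 0.

(* the Plücker vector of A, as a point of K^{P([n])} (non-k-subsets
   have coordinate 0) *)
Definition plucker (F : comNzRingType) (k n : nat) (A : 'M[F]_(k, n)) :
  {set 'I_n} -> F := fun S => minor A S.

Definition grass_cone (K : fieldType) (k n : nat) : pt K {set 'I_n} -> Prop :=
  fun x => exists A : 'M[K]_(k, n), \rank A = k /\ x = plucker A.

(* affine cone over the matroid stratum X°(M), M given by its bases *)
Definition stratum_cone (K : fieldType) (k n : nat) (B : {set {set 'I_n}}) :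
  pt K {set 'I_n} -> Prop :=
  fun x => exists A : 'M[K]_(k, n),
    [/\ \rank A = k, x = plucker A & forall S, (minor A S != 0) = (S \in B)].

Definition is_positroid (R : realType) (k n : nat) (B : {set {set 'I_n}}) :=
  exists A : 'M[R]_(k, n),
    [/\ \rank A = k, forall S : {set 'I_n}, #|S| = k -> 0 <= minor A S
      & forall S, (S \in B) = (minor A S != 0)].

Definition mrk (n : nat) (B : {set {set 'I_n}}) (S : {set 'I_n}) : nat :=
  \max_(b in B) #|S :&: b|.

Definition cS (n : nat) (B : {set {set 'I_n}}) (S : {set 'I_n}) : int :=
  (#|S|%:Z - (mrk B S)%:Z).

(* a_Sf(S) = c(S) - sum_{T in Sf, T proper subset of S} a_Sf(T), a(∅) = 0,
   computed by recursion with fuel #|S| *)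
Fixpoint a_aux (n : nat) (B : {set {set 'I_n}}) (Sf : {set {set 'I_n}})
    (fuel : nat) (S : {set 'I_n}) : int :=
  match fuel with
  | 0 => 0
  | fuel'.+1 => cS B S - \sum_(T in Sf | T \proper S) a_aux B Sf fuel' T
  end.

Definition a_fam (n : nat) (B : {set {set 'I_n}}) (Sf : {set {set 'I_n}})
    (S : {set 'I_n}) : int := a_aux B Sf #|S| S.

Definition ec_fam (k n : nat) (B : {set {set 'I_n}}) (Sf : {set {set 'I_n}}) : int :=
  \sum_(S in Sf) ((k%:Z - (mrk B S)%:Z) * a_fam B Sf S).

Definition ec (k n : nat) (B : {set {set 'I_n}}) : int :=
  ec_fam k B [set: {set 'I_n}].

(* Main.v *)
(**
Write r for the rank function of P and a = a_fam for the Möbius inverse of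
c(S) = #S - r(S).  Then ec(P) = k(n - k) - D with D the sum of r(S) a(S) over all
S, so the claim is that the stratum of P has dimension D in the Grassmannian.
Both sides are computed by adding the columns one at a time.

Combinatorial side.  Adding column m to the prefix [0, m) changes D by the sum of
r(S + m) alpha(S), where alpha is the Möbius inverse of the indicator of
"m lies in the closure of T".  For a totally nonnegative matrix, the sign of the
maximal minors gives a separation property: if m lies in the closure of T, but
of no cyclic interval surrounding m (with m removed) contained in T, then the
contraction by T is a direct sum of two nontrivial pieces.  Hence such T
contribute zero, and the sum reduces to an alternating sum of ranks over the
staircase of minimal cyclic intervals around m.

Geometric side.  Over a matrix X with the right prefix matroid, the admissible
columns m form a dense open subset of the intersection U of the spans of these
cyclic intervals, because the same direct sum decompositions show that U lies in
the span of every T whose closure contains m.  Consecutive intervals of the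
staircase overlap so well that dim U is exactly the alternating sum above.  So the
row echelon forms of the points of the stratum are covered by finitely many
charts, parametrized by D of the matrix entries, and one of them contains the
given totally nonnegative matrix.

Krull dimension.  A chain Z_0 < ... < Z_e of irreducible closed sets yields e
polynomials f_i, vanishing on Z_i but not on Z_(i+1), whose monomials are linearly
independent on Z_e; counting monomials against the polynomials in the d chart
parameters gives e <= d.  Conversely, freezing the parameters of one chart one
after the other gives a chain of length d.
*)

Require Import Defs.
From HB Require Import structures.
From mathcomp Require Import all_boot all_order all_algebra.
From mathcomp Require Import reals.
From mathcomp Require Import complex.
From mathcomp Require Import perm boolp mpoly ring zify.

Set Implicit Arguments.
Unset Strict Implicit.
Unset Printing Implicit Defensive.

Import Order.TTheory GRing.Theory Num.Theory.
Local Open Scope ring_scope.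

(** * Regular functions on principal open sets *)

Section PolynomialFunctions.
Variable K : fieldType.
Implicit Types (I J : finType).

Definition polyfun I (u : (I -> K) -> K) :=
  exists p : polyI K I, forall x, u x = peval p x.

Lemma polyfun_ext I (u v : (I -> K) -> K) :
  (forall x, u x = v x) -> polyfun u -> polyfun v.
Proof. by move=> uv [p up]; exists p => x; rewrite -uv. Qed.

Lemma polyfun_const I (c : K) : @polyfun I (fun=> c).
Proof. by exists (c%:MP) => x; rewrite /peval mevalC. Qed.

Lemma polyfun_coord I (i : I) : polyfun (fun x => x i).
Proof. by exists ('X_(enum_rank i)) => x; rewrite /peval mevalXU enum_rankK. Qed.

Lemma polyfun_add I (u v : (I -> K) -> K) :
  polyfun u -> polyfun v -> polyfun (fun x => u x + v x).
Proof.
by move=> [p up] [q vq]; exists (p + q) => x; rewrite up vq /peval mevalD.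
Qed.

Lemma polyfun_mul I (u v : (I -> K) -> K) :
  polyfun u -> polyfun v -> polyfun (fun x => u x * v x).
Proof.
by move=> [p up] [q vq]; exists (p * q) => x; rewrite up vq /peval mevalM.
Qed.

Lemma polyfun_exp I (u : (I -> K) -> K) m :
  polyfun u -> polyfun (fun x => u x ^+ m).
Proof.
move=> pu; elim: m => [|m IH]; first exact: polyfun_const.
by apply: polyfun_ext (polyfun_mul pu IH) => x; rewrite exprS.
Qed.

Lemma polyfun_sum I (T : Type) (s : seq T) (P : pred T) (F : T -> (I -> K) -> K) :
  (forall t, P t -> polyfun (F t)) ->
  polyfun (fun x => \sum_(t <- s | P t) F t x).
Proof.
move=> pF; elim: s => [|t s IH].
  by apply: polyfun_ext (polyfun_const I 0) => x; rewrite big_nil.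
case: (boolP (P t)) => Pt; last first.
  by apply: polyfun_ext IH => x; rewrite big_cons (negbTE Pt).
by apply: polyfun_ext (polyfun_add (pF t Pt) IH) => x; rewrite big_cons Pt.
Qed.

Lemma polyfun_prod I (T : Type) (s : seq T) (P : pred T) (F : T -> (I -> K) -> K) :
  (forall t, P t -> polyfun (F t)) ->
  polyfun (fun x => \prod_(t <- s | P t) F t x).
Proof.
move=> pF; elim: s => [|t s IH].
  by apply: polyfun_ext (polyfun_const I 1) => x; rewrite big_nil.
case: (boolP (P t)) => Pt; last first.
  by apply: polyfun_ext IH => x; rewrite big_cons (negbTE Pt).
by apply: polyfun_ext (polyfun_mul (pF t Pt) IH) => x; rewrite big_cons Pt.
Qed.

Lemma polyfun_peval I (p : polyI K I) : polyfun (peval p).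
Proof. by exists p. Qed.

Lemma polyfun_comp I J (u : (I -> K) -> K) (f : I -> (J -> K) -> K) :
  polyfun u -> (forall i, polyfun (f i)) -> polyfun (fun t => u (fun i => f i t)).
Proof.
move=> [p up] pf.
apply: (polyfun_ext (u := fun t => \sum_(m <- msupp p)
   p@_m * \prod_(i : 'I_#|I|) f (enum_val i) t ^+ m i)).
  by move=> t; rewrite up /peval mevalE.
apply: polyfun_sum => m _; apply: polyfun_mul; first exact: polyfun_const.
by apply: polyfun_prod => i _; apply: polyfun_exp.
Qed.

(** Restricting to the line through [x] and [y] turns questions of nonvanishing on chart domains
    into questions about roots of one-variable polynomials. *)
Lemma polyfun_line I (u : (I -> K) -> K) (x y : I -> K) : polyfun u ->
  exists q : {poly K}, forall s, u (fun i => x i + s * (y i - x i)) = q.[s].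
Proof.
move=> [p up].
exists (\sum_(m <- msupp p) p@_m *: \prod_(i : 'I_#|I|)
   ((x (enum_val i))%:P + 'X * (y (enum_val i) - x (enum_val i))%:P) ^+ m i).
move=> s; rewrite up /peval mevalE horner_sum; apply: eq_bigr => m _.
rewrite hornerZ horner_prod; congr (_ * _); apply: eq_bigr => i _.
by rewrite horner_exp hornerD hornerM !hornerC hornerX.
Qed.

(* [u] is a regular function on the principal open set [h <> 0]. *)
Definition reg I (h u : (I -> K) -> K) :=
  exists (N : (I -> K) -> K) (L : nat),
    polyfun N /\ forall t, h t != 0 -> u t * h t ^+ L = N t.

Section Reg.
Variables (I : finType) (h : (I -> K) -> K).
Hypothesis ph : polyfun h.

Lemma reg_ext u v : (forall t, h t != 0 -> u t = v t) -> reg h u -> reg h v.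
Proof.
by move=> uv [N [L [pN e]]]; exists N, L; split=> // t ht; rewrite -uv // e.
Qed.

Lemma reg_poly u : polyfun u -> reg h u.
Proof. by move=> pu; exists u, 0%N; split=> // t _; rewrite expr0 mulr1. Qed.

Lemma reg_const c : reg h (fun=> c).
Proof. exact/reg_poly/polyfun_const. Qed.

Lemma reg_mul u v : reg h u -> reg h v -> reg h (fun t => u t * v t).
Proof.
move=> [N [L [pN eN]]] [M [L' [pM eM]]].
exists (fun t => N t * M t), (L + L')%N; split; first exact: polyfun_mul.
by move=> t ht; rewrite -eN // -eM // exprD mulrACA.
Qed.

Lemma reg_add u v : reg h u -> reg h v -> reg h (fun t => u t + v t).
Proof.
move=> [N [L [pN eN]]] [M [L' [pM eM]]].
exists (fun t => N t * h t ^+ L' + M t * h t ^+ L), (L + L')%N; split.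
  by apply: polyfun_add; apply: polyfun_mul => //; apply: polyfun_exp.
by move=> t ht; rewrite -eN // -eM // exprD; ring.
Qed.

Lemma reg_sum (T : Type) (s : seq T) (P : pred T) (F : T -> (I -> K) -> K) :
  (forall t, P t -> reg h (F t)) -> reg h (fun x => \sum_(t <- s | P t) F t x).
Proof.
move=> pF; elim: s => [|t s IH].
  by apply: reg_ext (reg_const 0) => x; rewrite big_nil.
case: (boolP (P t)) => Pt; last first.
  by apply: reg_ext IH => x; rewrite big_cons (negbTE Pt).
by apply: reg_ext (reg_add (pF t Pt) IH) => x; rewrite big_cons Pt.
Qed.

Lemma reg_prod (T : Type) (s : seq T) (P : pred T) (F : T -> (I -> K) -> K) :
  (forall t, P t -> reg h (F t)) -> reg h (fun x => \prod_(t <- s | P t) F t x).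
Proof.
move=> pF; elim: s => [|t s IH].
  by apply: reg_ext (reg_const 1) => x; rewrite big_nil.
case: (boolP (P t)) => Pt; last first.
  by apply: reg_ext IH => x; rewrite big_cons (negbTE Pt).
by apply: reg_ext (reg_mul (pF t Pt) IH) => x; rewrite big_cons Pt.
Qed.

Lemma reg_exp u m : reg h u -> reg h (fun x => u x ^+ m).
Proof.
move=> pu; elim: m => [|m IH]; first exact: reg_const.
by apply: reg_ext (reg_mul pu IH) => x _; rewrite exprS.
Qed.

Lemma reg_det k (M : (I -> K) -> 'M[K]_k) :
  (forall i j, reg h (fun x => M x i j)) -> reg h (fun x => \det (M x)).
Proof.
move=> pM; rewrite /determinant; apply: reg_sum => s _.
by apply: reg_mul; [apply: reg_const | apply: reg_prod].
Qed.

Lemma reg_comp J (u : (J -> K) -> K) (f : J -> (I -> K) -> K) :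
  polyfun u -> (forall i, reg h (f i)) -> reg h (fun t => u (fun i => f i t)).
Proof.
move=> [p up] pf.
apply: (reg_ext (u := fun t => \sum_(m <- msupp p)
   p@_m * \prod_(i : 'I_#|J|) f (enum_val i) t ^+ m i)).
  by move=> t _; rewrite up /peval mevalE.
apply: reg_sum => m _; apply: reg_mul; first exact: reg_const.
by apply: reg_prod => i _; apply: reg_exp.
Qed.

Lemma reg_mulmx a b c (M : (I -> K) -> 'M[K]_(a, b)) (N : (I -> K) -> 'M[K]_(b, c)) :
  (forall i j, reg h (fun x => M x i j)) ->
  (forall i j, reg h (fun x => N x i j)) ->
  forall i j, reg h (fun x => (M x *m N x) i j).
Proof.
move=> rM rN i j; apply: (reg_ext (u := fun x => \sum_l M x i l * N x l j)).
  by move=> x _; rewrite mxE.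
by apply: reg_sum => l _; apply: reg_mul.
Qed.

(** Where [h] is nonzero, [g] and its numerator [N] vanish together, so [h * N] cuts out the smaller
    open set, on which the inverse of [g] becomes regular. *)
Lemma reg_localize g : reg h g ->
  exists h', [/\ polyfun h', forall t, (h' t != 0) = (h t != 0) && (g t != 0),
    forall u, reg h u -> reg h' u & reg h' (fun t => (g t)^-1)].
Proof.
move=> [N [L [pN eN]]].
have E t : (h t * N t != 0) = (h t != 0) && (g t != 0).
  case: (boolP (h t == 0)) => [/eqP -> | ht]; first by rewrite mul0r eqxx.
  by rewrite mulf_eq0 (negbTE ht) -eN // mulf_eq0 expf_eq0 (negbTE ht) andbF orbF.
exists (fun t => h t * N t); split=> //; first exact: polyfun_mul.
- move=> u [M [m [pM eM]]]; exists (fun t => M t * N t ^+ m), m; split.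
    by apply: polyfun_mul => //; apply: polyfun_exp.
  by move=> t; rewrite E => /andP[ht _]; rewrite exprMn mulrA eM.
- exists (fun t => h t ^+ L.+1), 1%N; split; first exact: polyfun_exp.
  move=> t; rewrite E expr1 => /andP[ht gt].
  by rewrite -eN // exprS; field.
Qed.

End Reg.

Lemma reg_pull I J (h u : (I -> K) -> K) (f : I -> (J -> K) -> K) :
  (forall i, polyfun (f i)) -> reg h u ->
  reg (fun t => h (fun i => f i t)) (fun t => u (fun i => f i t)).
Proof.
move=> pf [N [L [pN eN]]]; exists (fun t => N (fun i => f i t)), L.
by split=> [|t ht]; [apply: polyfun_comp | rewrite eN].
Qed.

End PolynomialFunctions.

(** * Upper bound on the Krull dimension *)

Section Zariski.
Variables (K : fieldType) (I : finType).
Implicit Types (S Z : pt K I -> Prop).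

Lemma zclosed_zclosure S : zclosed (zclosure S).
Proof.
exists (fun p => forall x, S x -> peval p x = 0) => x; split.
  move=> Sx p pS; apply: (Sx (fun y => peval p y = 0)); last exact: pS.
  exists (fun q => q = p) => y; split=> [py q -> // | ]; exact.
move=> pS Z [F ZF] SZ; apply/ZF => p Fp; apply: pS => y Sy.
by move/ZF: (SZ _ Sy); apply.
Qed.

Lemma sub_zclosure S : psubset S (zclosure S).
Proof. by move=> x Sx Z _; apply. Qed.

Lemma zclosure_min S Z : zclosed Z -> psubset S Z -> psubset (zclosure S) Z.
Proof. by move=> cZ SZ x; apply. Qed.

Lemma zclosed_zero (u : pt K I -> K) : polyfun u -> zclosed (fun x => u x = 0).
Proof.
move=> [p up]; exists (fun q => q = p) => x; split=> [ux q ->|].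
  by rewrite -up.
by rewrite up; apply.
Qed.

Lemma zclosedPn Z x : zclosed Z -> ~ Z x ->
  exists u, [/\ polyfun u, forall y, Z y -> u y = 0 & u x != 0].
Proof.
move=> [F ZF] nZx; have : ~ zero_set F x by move=> /ZF.
move=> /existsNP[p] /not_implyP[Fp px]; exists (peval p).
split; [exact: polyfun_peval | by move=> y /ZF; apply | exact/eqP].
Qed.

End Zariski.

(** * Growth of spaces of monomials: chains against charts *)

Section Growth.
Variables (K : fieldType) (I : finType).
Implicit Types (S : pt K I -> Prop).

(* Exponents [(a_0, ..., a_{e-1})] with all [a_i < M]. *)
Fixpoint expo (M e : nat) : finType :=
  if e is e'.+1 then (expo M e' * 'I_M)%type else unit.

Fixpoint monom (f : nat -> pt K I -> K) (M e : nat) : expo M e -> pt K I -> K :=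
  match e return expo M e -> pt K I -> K with
  | 0 => fun _ _ => 1
  | e'.+1 => fun a x => monom f a.1 x * f e' x ^+ a.2
  end.

Lemma card_expo M e : #|expo M e| = (M ^ e)%N.
Proof.
elim: e => [|e IH] /=; first by rewrite card_unit.
by rewrite card_prod IH card_ord expnSr.
Qed.

Lemma sum_expoS M e (F : expo M e.+1 -> K) :
  \sum_b F b = \sum_(a : expo M e) \sum_(i < M) F (a, i).
Proof. by rewrite pair_big /=; apply: eq_bigr => -[]. Qed.

Lemma polyfun_monom f M e (a : expo M e) :
  (forall i, polyfun (f i)) -> polyfun (monom f a).
Proof.
move=> pf; elim: e a => [|e IH] /= a; first exact: polyfun_const.
by apply: polyfun_mul; [apply: IH | apply: polyfun_exp].
Qed.

Definition free_on S (T : finType) (g : T -> pt K I -> K) :=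
  forall c : T -> K, (forall x, S x -> \sum_a c a * g a x = 0) -> forall a, c a = 0.

(** Induction along the chain. In a relation on [Z e.+1] the lowest power of [f e] can be cancelled,
    since [Z e.+1] is irreducible and [f e] is not zero on it. Restricting to [Z e], where [f e]
    vanishes, leaves a relation between the monomials in the earlier polynomials. *)
Lemma chain_monom_free Y d Z (f : nat -> pt K I -> K) M :
  irr_chain Y d Z ->
  (forall i, (i < d)%N -> [/\ polyfun (f i), forall x, Z i x -> f i x = 0
       & exists2 x, Z i.+1 x & f i x != 0]) ->
  forall e, (e <= d)%N -> free_on (Z e) (@monom f M e).
Proof.
move=> [irrZ strZ _] fP; elim=> [|e IH] le_ed.
  have [_ [x Zx] _] := irrZ 0%N isT.
  by move=> c /(_ x Zx); rewrite (big_pred1 tt) ?mulr1 => [c0 []|[]].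
have [pf f0 [x1 Zx1 fx1]] := fP e le_ed.
have pf' i : (i <= e)%N -> polyfun (f i) by move=> ie; case: (fP i (leq_ltn_trans ie le_ed)).
have pmon e' (a : expo M e') : (e' <= e.+1)%N -> polyfun (monom f a).
  elim: e' a => [|e' IH'] /= a lee; first exact: polyfun_const.
  by apply: polyfun_mul; [apply/IH'/ltnW | apply/polyfun_exp/pf'].
have [subZ _] := strZ e le_ed.
move=> c c0.
have key : forall j (a : expo M e) (i : 'I_M), (i < j)%N -> c (a, i) = 0.
  elim=> // j IHj a i; rewrite ltnS leq_eqVlt => /orP[/eqP ij|]; last exact: IHj.
  (* The coefficients with exponent below [j] are already zero, so [G] is the relation divided by
     the [j]-th power of [f e]. *)
  pose G x := \sum_(b : expo M e) \sum_(l < M | (j <= l)%N)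
      c (b, l) * (monom f b x * f e x ^+ (l - j)).
  have pG : polyfun G.
    apply: polyfun_sum => b _; apply: polyfun_sum => l _.
    apply: polyfun_mul; first exact: polyfun_const.
    by apply: polyfun_mul; [apply/pmon/leqW | apply: polyfun_exp].
  have fG x : Z e.+1 x -> f e x ^+ j * G x = 0.
    move=> Zx; rewrite -[RHS](c0 x Zx) sum_expoS mulr_sumr; apply: eq_bigr => b _.
    rewrite mulr_sumr [RHS](bigID (fun l : 'I_M => (j <= l)%N)) /=.
    rewrite [X in _ = _ + X]big1 ?addr0.
      apply: eq_bigr => l jl; rewrite -[in RHS](subnK jl) exprD; ring.
    by move=> l; rewrite -ltnNge => lt_lj; rewrite IHj ?mul0r.
  have [_ _ irr] := irrZ e.+1 le_ed.
  have G0 : psubset (Z e.+1) (fun x => G x = 0).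
    case: (irr (fun x => f e x = 0) (fun x => G x = 0)) => //.
    - by apply: zclosed_zero; apply: pf'.
    - exact: zclosed_zero.
    - move=> x Zx; move/eqP: (fG x Zx); rewrite mulf_eq0 expf_eq0.
      by case/orP=> [/andP[_ /eqP]|/eqP]; [left|right].
    - by move=> sub; move: fx1; rewrite sub ?eqxx.
  (* On [Z e] only the term [l = j] of [G] survives. *)
  apply: (IH (ltnW le_ed) (fun a => c (a, i))) => x Zx.
  rewrite -[RHS](G0 x (subZ x Zx)) /G; apply: eq_bigr => b _.
  rewrite (bigD1 i) ?ij //= subnn expr0 mulr1 big1 ?addr0 // => l /andP[jl li].
  rewrite f0 // expr0n subn_eq0.
  have -> : (l <= j)%N = false; last by rewrite !mulr0.
  apply/negbTE; rewrite -ltnNge ltn_neqAle jl andbT -ij.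
  by apply: contra li => /eqP ?; apply/eqP/val_inj.
by case=> a i; apply: (key i.+1).
Qed.

(* The restrictions to [S] of the monomials of partial degrees [< M] in finitely
   many polynomials span a space of dimension [O(M^d)]. *)
Definition dimle (d : nat) S :=
  forall e (f : nat -> pt K I -> K), (forall i, (i < e)%N -> polyfun (f i)) ->
  exists C : nat, forall M, (0 < M)%N -> exists (B : finType) (g : B -> pt K I -> K)
      (a : expo M e -> B -> K),
    (#|B| <= C * M ^ d)%N /\
    forall x, S x -> forall t, monom f t x = \sum_b a t b * g b x.

Lemma dimle_sub d S S' : psubset S' S -> dimle d S -> dimle d S'.
Proof.
move=> sub dS e f pf; have [C CP] := dS e f pf; exists C => M M0.
have [B [g [a [cB eB]]]] := CP M M0; exists B, g, a; split=> // x Sx t.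
exact/eB/sub.
Qed.

(** The functions [g b] in [dimle] may be arbitrary, so spanning families of the pieces can be
    glued: [w] selects for each point one piece containing it, and the functions of all other pieces
    are set to 0 there. *)
Lemma dimle_bigcup d (J : finType) (S : J -> pt K I -> Prop) :
  (forall j, dimle d (S j)) -> dimle d (fun x => exists j, S j x).
Proof.
move=> dS e f pf.
have [C CP] := choice (fun j => dS j e f pf).
exists (\sum_j C j)%N => M M0.
pose Q (j : J) (p : {B : finType & ((B -> pt K I -> K) * (expo M e -> B -> K))%type}) :=
  (#|tag p| <= C j * M ^ d)%N /\ forall x, S j x -> forall t,
    monom f t x = \sum_b (tagged p).2 t b * (tagged p).1 b x.
have [p pP] : {p & forall j, Q j (p j)}.
  apply: choice => j; have [B [g [a aP]]] := CP j M M0.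
  by exists (existT _ B (g, a)).
pose B j := tag (p j); pose g j := (tagged (p j)).1; pose a j := (tagged (p j)).2.
pose W (x : pt K I) (o : option J) := (exists j, S j x) -> exists2 j, o = Some j & S j x.
have [w wP] : {w & forall x, W x (w x)}.
  apply: choice => x; have [[j Sjx]|no] := pselect (exists j, S j x).
    by exists (Some j) => _; exists j.
  by exists None.
exists {j : J & B j}, (fun b x => if w x == Some (tag b) then g (tag b) (tagged b) x else 0),
  (fun t b => a (tag b) t (tagged b)); split.
  rewrite card_tagged sumnE big_map big_enum /= big_distrl /=.
  by apply: leq_sum => j _; case: (pP j).
move=> x Sx t; have [j wx Sjx] := wP x Sx.
have [_ -> //] := pP j; rewrite wx.
rewrite -(sig_big_dep xpredT (fun=> xpredT) (fun i b => a i t b *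
   (if Some j == Some i then g i b x else 0))) /= (bigD1 j) //= [X in _ = _ + X]big1.
  by rewrite addr0; apply: eq_bigr => b _; rewrite eqxx.
move=> i ij; rewrite big1 // => b _.
by rewrite (inj_eq Some_inj) eq_sym (negbTE ij) mulr0.
Qed.

Lemma underdetermined (T B : finType) (a : T -> B -> K) : (#|B| < #|T|)%N ->
  exists c : T -> K, (exists t, c t != 0) /\ forall b, \sum_t c t * a t b = 0.
Proof.
move=> cBT; pose A := \matrix_(i < #|T|, j < #|B|) a (enum_val i) (enum_val j).
have : kermx A != 0.
  rewrite -mxrank_eq0 mxrank_ker subn_eq0 -ltnNge.
  by apply: leq_ltn_trans cBT; apply: rank_leq_col.
case/rowV0Pn=> v /sub_kermxP vA /rV0Pn[i vi].
exists (fun t => v 0 (enum_rank t)); split.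
  by exists (enum_val i); rewrite enum_valK.
move=> b; have /matrixP/(_ 0 (enum_rank b)) := vA; rewrite !mxE => vAb.
rewrite (reindex_onto enum_val enum_rank) /=; last by move=> t _; rewrite enum_rankK.
rewrite -[RHS]vAb; apply: eq_big => [j|j _]; first by rewrite enum_valK eqxx.
by rewrite !mxE enum_rankK enum_valK.
Qed.

(** If [d < e], there are more monomials than functions spanning their restrictions to [S]. Some
    nontrivial combination then vanishes on [S], hence on its closure and on the top of the chain,
    against [chain_monom_free]. *)
Lemma dimle_chain d S e Z : dimle d S -> irr_chain (zclosure S) e Z -> (e <= d)%N.
Proof.
move=> dS ch; rewrite leqNgt; apply/negP => lt_de.
have [irrZ strZ subZ] := ch.
pose Q i (u : pt K I -> K) := polyfun u /\ ((i < e)%N ->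
  [/\ polyfun u, forall x, Z i x -> u x = 0 & exists2 x, Z i.+1 x & u x != 0]).
have [f fP] : {f & forall i, Q i (f i)}.
  apply: choice => i; case: (ltnP i e) => [lt_ie|le_ei]; last first.
    by exists (fun=> 0); split; [apply: polyfun_const | rewrite ltnNge le_ei].
  have [_ nsub] := strZ i lt_ie; have [cZ _ _] := irrZ i (ltnW lt_ie).
  have [x /not_implyP[Zx nZx]] : exists x, ~ (Z i.+1 x -> Z i x) by apply/existsNP.
  have [u [pu u0 ux]] := zclosedPn cZ nZx.
  by exists u; split=> // _; split=> //; exists x.
have pf i : polyfun (f i) by case: (fP i).
have [C CP] := dS e f (fun i _ => pf i).
(* With [M = C.+1] one has [C * M ^ d < M ^ d.+1 <= M ^ e]. *)
have [//|B [g [a [cB eB]]]] := CP C.+1 _.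
have cT : (#|B| < #|expo C.+1 e|)%N.
  rewrite card_expo (leq_ltn_trans cB) //.
  apply: leq_trans (_ : C.+1 ^ d.+1 <= _)%N; last by rewrite leq_pexp2l.
  by rewrite expnS ltn_pmul2r ?expn_gt0.
have [c [[t ct] cK]] := underdetermined a cT.
have c0 x : S x -> \sum_t c t * monom f t x = 0.
  move=> Sx; rewrite (eq_bigr (fun t => \sum_b c t * a t b * g b x)); last first.
    by move=> t' _; rewrite eB // mulr_sumr; apply: eq_bigr => b _; rewrite mulrA.
  rewrite exchange_big big1 // => b _; by rewrite -mulr_suml cK mul0r.
have free := chain_monom_free (M := C.+1) ch (fun i => (fP i).2) (leqnn e).
move: ct; rewrite free ?eqxx // => x Zx.
apply: (subZ x Zx (fun y => \sum_t c t * monom f t y = 0)); last exact: c0.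
apply: zclosed_zero; apply: polyfun_sum => t' _.
by apply: polyfun_mul; [apply: polyfun_const | apply: polyfun_monom].
Qed.

Lemma card_bmultinom n k : (#|{: 'X_{1..n < k}}| <= k ^ n)%N.
Proof.
case: k => [|k].
  case: n => [|n]; last first.
    by rewrite eq_card0 // => m; have := bmdeg m; rewrite ltn0.
  by rewrite expn0 -(card_unit); apply: (@leq_card _ _ (fun=> tt)) => m; have := bmdeg m; rewrite ltn0.
pose g (m : 'X_{1..n < k.+1}) : {ffun 'I_n -> 'I_k.+1} := [ffun i => inord (m i)].
have gI : injective g.
  move=> m m' /ffunP gm; apply/val_inj/mnmP => i; have := gm i; rewrite !ffunE.
  have lt (m0 : 'X_{1..n < k.+1}) : (m0 i < k.+1)%N.
    apply: leq_ltn_trans (bmdeg m0); rewrite mdegE (bigD1 i) //=; exact: leq_addr.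
  by move/(congr1 val); rewrite /= !inordK.
by have := leq_card g gI; rewrite card_ffun !card_ord.
Qed.

Lemma msize_exp_le n (p : {mpoly K[n]}) j : (msize (p ^+ j) <= (msize p).+1 * j + 1)%N.
Proof.
elim: j => [|j IH]; first by rewrite expr0 msize1 muln0.
rewrite exprS; apply: leq_trans (msizeM_le _ _) _; nia.
Qed.

Section Chart.
Variables (Th : finType) (h : (Th -> K) -> K) (phi : (Th -> K) -> pt K I).
Hypotheses (ph : polyfun h) (rphi : forall i, reg h (fun t => phi t i)).

(** Pulled back to the chart, all monomials with exponents below [M] acquire the same denominator, a
    power of [h] linear in [M], and numerators of degree linear in [M]. *)
Lemma monom_chart_degree e f : (forall i, (i < e)%N -> polyfun (f i)) ->
  exists C L, forall M, (0 < M)%N -> forall a : expo M e, exists q : polyI K Th,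
    (msize q <= C * M)%N /\
    forall t, h t != 0 -> monom f a (phi t) * h t ^+ (L * M) = peval q t.
Proof.
elim: e => [|e IH] pf.
  exists 1%N, 0%N => M M0 a; exists 1; rewrite msize1 mul1n; split=> // t _.
  by rewrite mul0n expr0 mulr1 /peval meval1.
have [|C [L CL]] := IH; first by move=> i lt_ie; apply/pf/leqW.
have [N [L0 [[p pN] eN]]] := reg_comp ph (pf e (ltnSn e)) rphi.
have [ph' phE] := ph.
exists (C + (msize p).+1 + (msize ph').+1 * L0 + 6)%N, (L + L0)%N => M M0 [a j] /=.
have [q [sq eq]] := CL M M0 a.
(* The last factor pads the denominator, so that its exponent does not depend on [j]. *)
exists (q * p ^+ j * ph' ^+ (L0 * (M - j))); split.
  apply: leq_trans (msizeM_le _ _) _.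
  have h1 := msizeM_le q (p ^+ j); have h2 := msize_exp_le p j.
  have h3 := msize_exp_le ph' (L0 * (M - j)).
  have h4 : ((msize ph').+1 * (L0 * (M - j)) <= (msize ph').+1 * L0 * M)%N.
    by rewrite mulnA leq_mul // leq_subr.
  have h5 : ((msize p).+1 * j <= (msize p).+1 * M)%N by rewrite leq_mul // ltnW.
  apply: leq_trans (_ : C * M + (msize p).+1 * M + (msize ph').+1 * L0 * M + 6 * M <= _)%N.
    move: h1 h2 h3 h4 h5 sq; move: ((msize p).+1 * M)%N ((msize p).+1 * j)%N.
    move: ((msize ph').+1 * L0 * M)%N ((msize ph').+1 * (L0 * (M - j)))%N (C * M)%N.
    by move: (msize (q * _)) (msize (ph' ^+ _)) (msize (p ^+ j)) (msize q) => *; lia.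
  by rewrite -!mulnDl.
move=> t ht; rewrite /peval !mevalM -!/(peval _ t) -eq //.
have pevX (r : polyI K Th) i : peval (r ^+ i) t = peval r t ^+ i.
  by elim: i => [|i IHi]; rewrite ?expr0 ?exprS /peval ?meval1 // mevalM; congr (_ * _).
have -> : ((L + L0) * M = L * M + (L0 * j + L0 * (M - j)))%N.
  by rewrite mulnDl -mulnDr subnKC // ltnW.
rewrite !pevX -pN -phE -eN // !exprD exprMn -exprM; ring.
Qed.

(** The numerators involve at most [(C * M) ^ #|Th|] parameter monomials. As functions of [x] these
    are evaluated at a parameter [w x] chosen for [x] and divided by the common denominator. *)
Lemma dimle_chart : dimle #|Th| (fun x => exists2 t, h t != 0 & x = phi t).
Proof.
move=> e f pf; have [C [L CL]] := monom_chart_degree pf.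
exists (C ^ #|Th|)%N => M M0.
have [q qP] := choice (CL M M0).
pose W (x : pt K I) (t : Th -> K) :=
  (exists2 t, h t != 0 & x = phi t) -> h t != 0 /\ x = phi t.
have [w wP] : {w & forall x, W x (w x)}.
  apply: choice => x; have [[t ht xt]|no] := pselect (exists2 t, h t != 0 & x = phi t).
    by exists t.
  by exists (fun=> 0) => /no.
exists {: 'X_{1..#|Th| < C * M}},
  (fun (m : 'X_{1..#|Th| < C * M}) x => peval 'X_[m] (w x) / h (w x) ^+ (L * M)), (fun t (m : 'X_{1..#|Th| < C * M}) => (q t)@_m); split.
  by rewrite -expnMn card_bmultinom.
move=> x Sx t; have [hw {1}->] := wP x Sx; have [sq eq] := qP t.
apply: (mulIf (expf_neq0 (L * M) hw)); rewrite eq // {1}(mpolywE sq).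
rewrite /peval raddf_sum mulr_suml; apply: eq_bigr => m _ /=.
by rewrite mevalZ mulrA divfK // expf_neq0.
Qed.

End Chart.

End Growth.

(** * Lower bound on the Krull dimension *)

Section LowerBound.
Variables (K : numFieldType) (I Th : finType).

(** In characteristic 0 the integers below [size p] are distinct, and they are too many to be all
    roots. *)
Lemma poly_neq0_nonroot (p : {poly K}) : p != 0 -> exists s, p.[s] != 0.
Proof.
move=> p0; apply: contrapT => /forallNP all0.
have := @max_poly_roots _ p [seq i%:R | i <- iota 0 (size p)] p0.
rewrite size_map size_iota ltnn => H.
have : false; last by [].
apply: H; last by rewrite map_inj_uniq ?iota_uniq // => i j /eqP; rewrite eqr_nat => /eqP.
by apply/allP => s _; rewrite /root; have /negP := all0 s; rewrite negbK.
Qed.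

Variables (h : (Th -> K) -> K) (phi : (Th -> K) -> pt K I) (S : pt K I -> Prop).
Variable t0 : Th -> K.
Hypotheses (ph : polyfun h) (rphi : forall i, reg h (fun t => phi t i)).
Hypotheses (hS : forall t, h t != 0 -> S (phi t)) (ht0 : h t0 != 0).
Hypothesis phi_inv : forall th : Th, exists n m : pt K I -> K,
  [/\ polyfun n, polyfun m &
      forall t, h t != 0 -> n (phi t) = t th * m (phi t) /\ m (phi t) != 0].

(** The image of the chart when the parameters numbered from [i] on are frozen at [t0]: a single
    point for [i = 0], the whole chart for [i = #|Th|]. *)
Let slice (i : nat) (x : pt K I) := exists t,
  [/\ h t != 0, forall th, (i <= enum_rank th)%N -> t th = t0 th & x = phi t].

Let line (t1 t2 : Th -> K) s : Th -> K := fun th => t1 th + s * (t2 th - t1 th).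

Let line0 t1 t2 : line t1 t2 0 = t1.
Proof. by apply: funext => th; rewrite /line mul0r addr0. Qed.

Let line1 t1 t2 : line t1 t2 1 = t2.
Proof. by apply: funext => th; rewrite /line mul1r addrC subrK. Qed.

(** If neither closed set contains the slice, take a point of the slice outside each. The parameter
    line joining them stays in the slice, and its general point lies outside both closed sets. *)
Lemma zirreducible_slice i : zirreducible (zclosure (slice i)).
Proof.
split; first exact: zclosed_zclosure.
  by exists (phi t0); apply: sub_zclosure; exists t0.
move=> Z1 Z2 cZ1 cZ2 cov; apply: contrapT => /not_orP[n1 n2].
have wit Z : zclosed Z -> ~ psubset (zclosure (slice i)) Z ->
    exists t u, [/\ h t != 0, forall th, (i <= enum_rank th)%N -> t th = t0 th,
      polyfun u, forall y, Z y -> u y = 0 & u (phi t) != 0].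
  move=> cZ nZ; apply: contrapT => no; apply: nZ; apply: zclosure_min => // x.
  move=> [t [ht tt0 ->]]; apply: contrapT => nZx.
  by have [u [pu u0 ux]] := zclosedPn cZ nZx; apply: no; exists t, u.
have [t1 [u1 [ht1 t1t0 pu1 u10 u1t]]] := wit _ cZ1 n1.
have [t2 [u2 [ht2 t2t0 pu2 u20 u2t]]] := wit _ cZ2 n2.
have [N1 [L1 [pN1 eN1]]] := reg_comp ph pu1 rphi.
have [N2 [L2 [pN2 eN2]]] := reg_comp ph pu2 rphi.
have [qh qhE] := polyfun_line t1 t2 ph.
have [q1 q1E] := polyfun_line t1 t2 pN1.
have [q2 q2E] := polyfun_line t1 t2 pN2.
(* A nonroot of this product keeps the parameter in the domain and both separating functions
   nonzero. *)
have : qh * q1 * q2 != 0.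
  rewrite !mulf_neq0 //.
  - by apply: contraNneq ht1 => q0; rewrite -(line0 t1 t2) /line qhE q0 horner0.
  - have : N1 t1 != 0 by rewrite -eN1 // mulf_neq0 ?expf_neq0.
    by apply: contraNneq => q0; rewrite -(line0 t1 t2) /line q1E q0 horner0.
  - have : N2 t2 != 0 by rewrite -eN2 // mulf_neq0 ?expf_neq0.
    by apply: contraNneq => q0; rewrite -(line1 t1 t2) /line q2E q0 horner0.
case/poly_neq0_nonroot => s; rewrite !hornerM -qhE -q1E -q2E -/(line t1 t2 s).
rewrite !mulf_eq0 !negb_or => /andP[/andP[hs N1s] N2s].
have Vs : slice i (phi (line t1 t2 s)).
  exists (line t1 t2 s); split=> // th ith.
  by rewrite /line t1t0 // t2t0 // subrr mulr0 addr0.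
case: (cov _ (sub_zclosure Vs)) => [/u10|/u20] u0.
  by move: N1s; rewrite -eN1 // u0 mul0r eqxx.
by move: N2s; rewrite -eN2 // u0 mul0r eqxx.
Qed.

(** The inclusions are strict because [phi_inv] recovers each parameter as a quotient of
    polynomials: one such polynomial vanishes on [slice i] but not after parameter [i] has been
    moved. *)
Lemma chart_chain : exists Z, irr_chain (zclosure S) #|Th| Z.
Proof.
exists (fun i => zclosure (slice i)); split; first by move=> i _; apply: zirreducible_slice.
  move=> i lt_i; split.
    apply: zclosure_min; first exact: zclosed_zclosure.
    move=> x [t [ht tt0 ->]]; apply: sub_zclosure; exists t; split=> // th lei.
    exact/tt0/ltnW.
  pose th := enum_val (Ordinal lt_i).
  have [n [m [pn pm nmE]]] := phi_inv th.
  (* This line moves the parameter [th] only; the factor ['X] below forces [s] to be nonzero, so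
     that it really moves. *)
  have [qh qhE] := polyfun_line t0 (fun th' => t0 th' + (th' == th)%:R) ph.
  have : qh * 'X != 0.
    rewrite mulf_neq0 ?polyX_eq0 //; apply: contraNneq ht0 => q0.
    rewrite -(line0 t0 (fun th' => t0 th' + (th' == th)%:R)).
    by rewrite /line qhE q0 horner0.
  case/poly_neq0_nonroot => s; rewrite hornerM hornerX -qhE mulf_eq0 negb_or.
  set t := (fun _ => _) => /andP[ht s0] sub.
  pose u x := n x + - (t0 th) * m x.
  have pu : polyfun u.
    by apply: polyfun_add => //; apply: polyfun_mul => //; apply: polyfun_const.
  have : u (phi t) = 0.
    have : zclosure (slice i.+1) (phi t).
      apply: sub_zclosure; exists t; split=> // th' lt_i'.
      rewrite /t [th' == th]negbTE; first by rewrite addr0 subrr mulr0 addr0.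
      by apply: contraTneq lt_i' => ->; rewrite enum_valK /= ltnn.
    move/sub => Zt; apply: (Zt (fun x => u x = 0)); first exact: zclosed_zero.
    move=> x [t' [ht' t't0 ->]]; have [nE _] := nmE t' ht'.
    by rewrite /u nE t't0 ?mulNr ?subrr // enum_valK.
  have [nE mt] := nmE t ht; rewrite /u nE -mulrDl => /eqP.
  rewrite mulf_eq0 (negbTE mt) orbF /t eqxx addrAC subrr add0r addrAC subrr add0r.
  by rewrite mulr1 (negbTE s0).
apply: (zclosure_min (@zclosed_zclosure _ _ S)).
by move=> x [t [ht _ ->]]; apply: sub_zclosure (hS ht).
Qed.

Lemma krull_dim_charts : dimle #|Th| S -> krull_dim (zclosure S) #|Th|.
Proof.
by move=> dS; split=> [|d' Z]; [apply: chart_chain | apply: dimle_chain].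
Qed.

End LowerBound.

(** * Column matroids and maximal minors *)

Section RowSpan.
Variables (F : fieldType) (p k : nat) (M : 'M[F]_(p, k)).
Implicit Types (S T I : {set 'I_p}).

(** Column spans are treated as row spans of the transpose: [rsp X^T T] is the span of the columns
    of [X] in [T]. *)
Definition rsp T : 'M[F]_k := (\sum_(i in T) <<row i M>>)%MS.
Definition rk T := \rank (rsp T).

Lemma row_rsp T i : i \in T -> (row i M <= rsp T)%MS.
Proof. by move=> iT; rewrite (sumsmx_sup i) // genmxE. Qed.

Lemma rsp_subP q (W : 'M_(q, k)) T :
  reflect (forall i, i \in T -> (row i M <= W)%MS) (rsp T <= W)%MS.
Proof.
apply: (iffP sumsmx_subP) => H i iT; first by rewrite -genmxE H.
by rewrite genmxE H.
Qed.

Lemma rspS S T : S \subset T -> (rsp S <= rsp T)%MS.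
Proof. by move=> /subsetP ST; apply/rsp_subP => i iS; apply/row_rsp/ST. Qed.

Lemma rspU S T : (rsp (S :|: T) :=: rsp S + rsp T)%MS.
Proof.
apply/eqmxP/andP; split.
  apply/rsp_subP => i; rewrite inE => /orP[] iS.
    exact: submx_trans (row_rsp iS) (addsmxSl _ _).
  exact: submx_trans (row_rsp iS) (addsmxSr _ _).
by rewrite addsmx_sub !rspS ?subsetUl ?subsetUr.
Qed.

Lemma rsp1 i : (rsp [set i] :=: row i M)%MS.
Proof.
apply/eqmxP/andP; split; last by rewrite row_rsp ?inE.
by apply/rsp_subP => j /set1P ->.
Qed.

Lemma rkS S T : S \subset T -> (rk S <= rk T)%N.
Proof. by move=> ST; apply/mxrankS/rspS. Qed.

Lemma rk0 : rk set0 = 0%N.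
Proof. by rewrite /rk /rsp big_set0 mxrank0. Qed.

Lemma rk_le T : (rk T <= k)%N.
Proof. exact: rank_leq_row. Qed.

Lemma rkU1 i T : rk (i |: T) = (rk T + ~~ (row i M <= rsp T)%MS)%N.
Proof.
rewrite /rk rspU; have := mxrank_sum_cap (rsp [set i]) (rsp T).
case: (boolP (row i M <= rsp T)%MS) => H /=.
  by move=> _; rewrite addn0 (addsmx_idPr _) ?rsp1.
have r1 : \rank (rsp [set i]) = 1%N.
  rewrite rsp1 rank_rV; suff -> : row i M != 0 by [].
  by apply: contraNneq H => ->; rewrite sub0mx.
have -> : \rank (rsp [set i] :&: rsp T)%MS = 0%N; last by rewrite addn0 r1 => ->; rewrite addnC.
apply/eqP; rewrite -leqn0 -ltnS -r1.
have := mxrank_leqif_sup (capmxSl (rsp [set i]) (rsp T)).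
case=> le; rewrite ltn_neqAle le andbT => ->.
by rewrite sub_capmx submx_refl /= rsp1.
Qed.

Lemma mem_rsp_rk i T : (row i M <= rsp T)%MS = (rk (i |: T) == rk T).
Proof. by rewrite rkU1; case: (_ <= _)%MS; rewrite ?addn0 ?eqxx // addn1 gtn_eqF. Qed.

Lemma rk_submod S T : (rk (S :|: T) + rk (S :&: T) <= rk S + rk T)%N.
Proof.
rewrite /rk rspU -(mxrank_sum_cap (rsp S)) leq_add2l; apply: mxrankS.
by rewrite sub_capmx !rspS ?subsetIl ?subsetIr.
Qed.

Lemma rk_card T : (rk T <= #|T|)%N.
Proof.
have [m] := ubnP #|T|; elim: m T => // m IH T.
have [->|[i iT]] := set_0Vmem T; first by rewrite rk0.
rewrite (cardsD1 i) iT ltnS => le; rewrite -{1}(setD1K iT) rkU1 addnC.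
by rewrite leq_add ?leq_b1 ?IH.
Qed.

Lemma rk_leU S T : (rk (S :|: T) <= rk S + #|T|)%N.
Proof.
apply: leq_trans (leq_addr (rk (S :&: T)) _) _.
by apply: leq_trans (rk_submod _ _) _; rewrite leq_add2l rk_card.
Qed.

Lemma rsp_eq S T : S \subset T -> rk S = rk T -> (rsp S :=: rsp T)%MS.
Proof.
move=> ST e; apply/eqmxP; rewrite rspS //=.
by have [_ <-] := mxrank_leqif_sup (rspS ST); rewrite -/(rk S) e.
Qed.

Definition indep I := rk I == #|I|.

Lemma indepS S T : S \subset T -> indep T -> indep S.
Proof.
move=> ST /eqP iT; rewrite /indep eqn_leq rk_card /= -(leq_add2r #|T :\: S|).
have -> : (#|S| + #|T :\: S| = #|T|)%N.
  by rewrite -(cardsID S T) (setIidPr ST).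
by rewrite -iT -{1}(setID T S) (setIidPr ST); apply: rk_leU.
Qed.

Lemma indepU1 i I : i \notin I -> indep I -> indep (i |: I) = ~~ (row i M <= rsp I)%MS.
Proof.
move=> iI /eqP e; rewrite /indep rkU1 e cardsU1 iI addnC eqn_add2r.
by case: (_ <= _)%MS.
Qed.

Lemma indep_extend I S : I \subset S -> indep I ->
  exists b : {set 'I_p}, [/\ I \subset b, b \subset S, indep b & rk b = rk S].
Proof.
have [m] := ubnP (rk S - rk I); elim: m I => // m IH I lem IS iI.
have := rkS IS; rewrite leq_eqVlt => /orP[/eqP e|lt]; first by exists I.
have [i /andP[iS nsub]] : exists i, (i \in S) && ~~ (row i M <= rsp I)%MS.
  apply/existsP; apply: contraTT lt; rewrite negb_exists -leqNgt => /forallP all.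
  apply: mxrankS; apply/rsp_subP => i iS.
  by have := all i; rewrite iS negbK.
have iI' : i \notin I by apply: contra nsub; apply: row_rsp.
have [|||b [Ib bS ib rb]] := IH (i |: I); last first.
- by exists b; split=> //; apply: subset_trans Ib; apply: subsetUr.
- by rewrite indepU1.
- by rewrite subUset sub1set iS IS.
- by move: lem lt; rewrite rkU1 nsub addn1; lia.
Qed.

Lemma basis_exists S : exists b : {set 'I_p}, [/\ b \subset S, indep b & rk b = rk S].
Proof.
have [||b [_ ? ? ?]] := @indep_extend set0 S; rewrite ?sub0set //.
  by rewrite /indep rk0 cards0.
by exists b.
Qed.

Lemma rowsub_rsp q (e : 'I_q -> 'I_p) T :
  (forall j, e j \in T) -> (forall i, i \in T -> exists j, e j = i) ->
  (rowsub e M :=: rsp T)%MS.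
Proof.
move=> eT Te; apply/eqmxP/andP; split.
  by apply/row_subP => j; rewrite row_rowsub row_rsp.
by apply/rsp_subP => i iT; have [j <-] := Te i iT; rewrite -row_rowsub row_sub.
Qed.

End RowSpan.

Lemma rsp_imset (F : fieldType) (p p' k : nat) (M : 'M[F]_(p, k)) (Q : 'M[F]_(p', k))
    (g : 'I_p -> 'I_p') (S : {set 'I_p}) :
  (forall c, row (g c) Q = row c M) -> (rsp Q (g @: S) :=: rsp M S)%MS.
Proof.
move=> gE; apply/eqmxP/andP; split.
  by apply/rsp_subP => _ /imsetP[c cS ->]; rewrite gE row_rsp.
by apply/rsp_subP => c cS; rewrite -gE row_rsp // imset_f.
Qed.

Lemma rsp_setT (F : fieldType) (p k : nat) (M : 'M[F]_(p, k)) : (rsp M setT :=: M)%MS.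
Proof.
apply/eqmxP/andP; split; first by apply/rsp_subP => i _; apply: row_sub.
by apply/row_subP => i; apply: row_rsp.
Qed.

(** * Minors, bases and the rank function *)

Section Minors.
Variables (F : fieldType) (k n : nat).
Implicit Types (X : 'M[F]_(k, n)) (S : {set 'I_n}).

Definition ecol S (cS : #|S| = k) (j : 'I_k) : 'I_n :=
  enum_val (cast_ord (esym cS) j).

Lemma nth_ecol S (cS : #|S| = k) (A : Type) (x0 : A) (f : 'I_n -> A) (j : 'I_k) :
  nth x0 [seq f c | c <- enum S] j = f (ecol cS j).
Proof.
have lt : (j < size (enum S))%N by rewrite -cardE cS.
rewrite (nth_map (ecol cS j)) //; congr f.
by rewrite [RHS](enum_val_nth (ecol cS j)).
Qed.

Lemma ecol_in S (cS : #|S| = k) j : ecol cS j \in S.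
Proof. exact: enum_valP. Qed.

Lemma ecol_inj S (cS : #|S| = k) : injective (ecol cS).
Proof. by move=> i j /enum_val_inj/cast_ord_inj. Qed.

Lemma ecol_surj S (cS : #|S| = k) i : i \in S -> exists j, ecol cS j = i.
Proof.
move=> iS; exists (cast_ord cS (enum_rank_in iS i)).
by rewrite /ecol cast_ordK enum_rankK_in.
Qed.

Lemma minorE X S (cS : #|S| = k) : minor X S = \det (colsub (ecol cS) X).
Proof.
rewrite /minor cS eqxx; congr (\det _); apply/matrixP => i j.
by rewrite !mxE nth_ecol.
Qed.

Lemma minor_neq0 X S : (minor X S != 0) = (#|S| == k) && (rk X^T S == k).
Proof.
case: (boolP (#|S| == k)) => [/eqP cS|ncS]; last by rewrite /minor (negbTE ncS) eqxx.
rewrite minorE -det_tr -unitfE -[_ \in _]/(_ \in unitmx) -row_free_unit /row_free /=.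
rewrite /rk; have -> : (colsub (ecol cS) X)^T = rowsub (ecol cS) X^T.
  by apply/matrixP => i j; rewrite !mxE.
by rewrite (@rowsub_rsp _ _ _ _ _ _ S) //; [apply: ecol_in | apply: ecol_surj].
Qed.

Lemma rk_setT X : \rank X = k -> rk X^T setT = k.
Proof.
by move=> rX; rewrite /rk rsp_setT mxrank_tr.
Qed.

Lemma minor_basis X S : \rank X = k ->
  (minor X S != 0) = (indep X^T S && (rk X^T S == rk X^T setT)).
Proof.
move=> rX; rewrite rk_setT // minor_neq0 /indep; move: (rk _ S) => r.
by rewrite andbC [RHS]andbC; case: (altP (r =P k)) => [->|//]; rewrite eq_sym.
Qed.

(** A basis meets [S] in an independent set, and a maximal independent subset of [S] extends to a
    basis. *)
Lemma mrkE X (P : {set {set 'I_n}}) S : \rank X = k ->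
  (forall b, (b \in P) = (minor X b != 0)) -> mrk P S = rk X^T S.
Proof.
move=> rX PX; apply/eqP; rewrite eqn_leq; apply/andP; split.
  apply/bigmax_leqP => b; rewrite PX minor_basis // => /andP[ib _].
  have /eqP <- := indepS (subsetIr S b) ib.
  by apply: rkS; apply: subsetIl.
have [I [IS iI rI]] := basis_exists X^T S.
have [b [Ib _ ib rb]] := indep_extend (subsetT I) iI.
have bP : b \in P by rewrite PX minor_basis // ib rb eqxx.
rewrite -rI (eqP iI) /mrk (bigD1 b) //= leq_max subset_leq_card //.
by rewrite subsetI IS.
Qed.

Lemma minor_mulmx (g : 'M[F]_k) X S : minor (g *m X) S = \det g * minor X S.
Proof.
case: (boolP (#|S| == k)) => [/eqP cS|ncS]; last by rewrite /minor (negbTE ncS) mulr0.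
rewrite !minorE -det_mulmx; congr (\det _).
by apply/matrixP => i j; rewrite !mxE; apply: eq_bigr => l _; rewrite mxE.
Qed.

(** The permutation that sorts the columns depends on [f] alone, so one sign serves for all [X]. *)
Lemma minor_unsorted (f : 'I_k -> 'I_n) : injective f ->
  exists s : bool, forall X, minor X (f @: setT) = (-1) ^+ s * \det (colsub f X).
Proof.
move=> fI; set S := f @: setT.
have cS : #|S| = k by rewrite card_imset // cardsT card_ord.
have /fin_all_exists[g gE] : forall j, exists i, f i = ecol cS j.
  move=> j; have /imsetP[i _ ->] := ecol_in cS j; by exists i.
have gI : injective g.
  by move=> i j e; apply: (ecol_inj (cS := cS)); rewrite -!gE e.
exists (odd_perm (perm gI)) => X; rewrite minorE.
have -> : colsub (ecol cS) X = col_perm (perm gI) (colsub f X).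
  by apply/matrixP => i j; rewrite !mxE permE gE.
by rewrite col_permE det_mulmx det_perm mulrC odd_permV.
Qed.

End Minors.

(** * Position of an element in the increasing enumeration *)

Section EnumCount.
Variables (k n : nat) (S : {set 'I_n}) (cS : #|S| = k).

Lemma ecol_mono (i j : 'I_k) : (i < j)%N -> (ecol cS i < ecol cS j)%N.
Proof.
move=> ij; have srt : sorted (fun a b : 'I_n => a < b)%N (enum S).
  rewrite {1}/enum_mem -enumT; apply: sorted_filter; first by move=> ? ? ?; apply: ltn_trans.
  by rewrite -[sorted _ _]/(sorted (relpre val ltn) _) -sorted_map val_enum_ord iota_ltn_sorted.
have szS : size (enum S) = k by rewrite -cardE cS.
have E (l : 'I_k) : ecol cS l = nth (ecol cS i) (enum S) l.
  by rewrite [LHS](enum_val_nth (ecol cS i)).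
rewrite (E j) {1}(E i).
apply: (sorted_ltn_nth (leT := fun a b : 'I_n => (a < b)%N)) => //.
- by move=> ? ? ?; apply: ltn_trans.
- by rewrite inE szS.
- by rewrite inE szS.
Qed.

Lemma card_ecol (j : 'I_k) : #|[set h in S | (h < ecol cS j)%N]| = j.
Proof.
have -> : [set h in S | (h < ecol cS j)%N] = ecol cS @: [set i : 'I_k | (i < j)%N].
  apply/setP => h; rewrite inE; apply/andP/imsetP => [[hS lt]|[i + ->]].
    have [i ei] := ecol_surj cS hS; exists i => //; rewrite inE ltnNge; rewrite -ei in lt.
    apply/negP; rewrite leq_eqVlt => /orP[/eqP/val_inj e|/ecol_mono]; last first.
      by rewrite ltnNge ltnW.
    by move: lt; rewrite e ltnn.
  by rewrite inE => ij; rewrite ecol_in ecol_mono.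
rewrite card_imset; last exact: ecol_inj.
rewrite -sum1_card (eq_bigl (fun i : 'I_k => (i < j)%N)); last by move=> i; rewrite inE.
by rewrite -(big_ord_widen k (fun=> 1%N)) ?sum1_card ?card_ord // ltnW.
Qed.

Lemma ecol_eq x (j : 'I_k) : x \in S -> #|[set h in S | (h < x)%N]| = j -> ecol cS j = x.
Proof. by move=> /(ecol_surj cS)[i <-]; rewrite card_ecol => /val_inj ->. Qed.

End EnumCount.

(** * Linear forms of hyperplanes spanned by columns *)

Section Cofactor.
Variables (F : fieldType) (k p : nat) (Z : 'M[F]_(k.+1, p)).
Implicit Types (H : {set 'I_p}) (u : 'rV[F]_k.+1).

Definition crows H : 'M[F]_(k, k.+1) :=
  \matrix_(i, a) nth 0 [seq Z a c | c <- enum H] i.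

(* For [#|H| = k], the linear form [u |-> det (u, columns of Z in H)]. *)
Definition kap H : 'cV[F]_k.+1 :=
  \col_a cofactor (col_mx (0 : 'rV_k.+1) (crows H) : 'M_k.+1) 0 a.

Lemma kapE H u : (u *m kap H) 0 0 = \det (col_mx u (crows H) : 'M_k.+1).
Proof.
rewrite mxE (expand_det_row _ 0); apply: eq_bigr => a _.
rewrite !mxE; congr (_ * _).
  by case: splitP => // i _; rewrite (ord1 i).
rewrite /cofactor; congr (_ * \det _); apply/matrixP => i j; rewrite !mxE.
case: splitP => [l|//] /= e; exfalso.
by have := ltn_ord l; rewrite -e /bump /= ltnS leqNgt.
Qed.

Section Card.
Variables (H : {set 'I_p}) (cH : #|H| = k).

Lemma crowsE : crows H = rowsub (ecol cH) Z^T.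
Proof. by apply/matrixP => i a; rewrite !mxE nth_ecol. Qed.

Lemma crows_rsp : (crows H :=: rsp Z^T H)%MS.
Proof.
by rewrite crowsE; apply: rowsub_rsp; [apply: ecol_in | apply: ecol_surj].
Qed.

Lemma kap_rsp u : (u <= rsp Z^T H)%MS -> u *m kap H = 0.
Proof.
rewrite -crows_rsp => /submxP[w ->]; rewrite -mulmxA.
suff -> : crows H *m kap H = 0 by rewrite mulmx0.
apply/matrixP => i j; rewrite (ord1 j) [RHS]mxE.
have -> : (crows H *m kap H) i 0 = (row i (crows H) *m kap H) 0 0.
  by rewrite -row_mul [RHS]mxE.
rewrite kapE (determinant_alternate (i1 := lshift k 0) (i2 := rshift 1 i)) //.
by move=> a; rewrite col_mxEu col_mxEd mxE.
Qed.

Lemma kap_notin u : indep Z^T H -> ~~ (u <= rsp Z^T H)%MS -> (u *m kap H) 0 0 != 0.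
Proof.
move=> iH uH; rewrite kapE -unitfE -[_ \in _]/(_ \in unitmx) -row_full_unit.
rewrite /row_full -[\rank _]/(\rank (col_mx u (crows H))) -addsmxE eqn_leq rank_leq_col /=.
have lt : (\rank (rsp Z^T H) < \rank (u + rsp Z^T H)%MS)%N.
  have [le eq] := mxrank_leqif_sup (addsmxSr u (rsp Z^T H)).
  by rewrite ltn_neqAle le andbT eq addsmx_sub (negbTE uH).
rewrite (adds_eqmx (eqmx_refl u) crows_rsp); apply: leq_trans lt.
by rewrite ltnS -/(rk _ _) (eqP iH) cH.
Qed.

Lemma kap_eq0 u : indep Z^T H -> (u *m kap H == 0) = (u <= rsp Z^T H)%MS.
Proof.
move=> iH; apply/eqP/idP => [u0|]; last exact: kap_rsp.
by apply/negPn/negP => /(kap_notin iH); rewrite u0 mxE eqxx.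
Qed.

(** Expansion along the column [v]; the sign counts the columns of [H] that precede it. *)
Lemma minorU1 v : v \notin H ->
  minor Z (v |: H) = (-1) ^+ #|[set h in H | (h < v)%N]| * (row v Z^T *m kap H) 0 0.
Proof.
move=> vH; set q := #|_|.
have ltq : (q < k.+1)%N by rewrite ltnS -cH subset_leq_card //; apply/subsetP => h; rewrite inE => /andP[].
have cS : #|v |: H| = k.+1 by rewrite cardsU1 vH cH.
pose Q : 'I_k.+1 := Ordinal ltq.
have eQ : ecol cS Q = v.
  apply: ecol_eq; first by rewrite !inE eqxx.
  congr #|pred_of_set _|; apply/setP => h; rewrite !inE.
  by case: (altP (h =P v)) => [->|]; rewrite ?ltnn ?andbF.
(* Skipping the position [Q] of [v] leaves the columns of [H] in their order. *)
have eL i : ecol cS (lift Q i) = ecol cH i.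
  set x := ecol cH i; have xH : x \in H by apply: ecol_in.
  have xv : x != v by apply: contraNneq vH => <-.
  apply: ecol_eq; first by rewrite inE xH orbT.
  have ci : #|[set h in H | (h < x)%N]| = i by apply: card_ecol.
  have -> : [set h in v |: H | (h < x)%N] =
            (if (v < x)%N then [set v] else set0) :|: [set h in H | (h < x)%N].
    apply/setP => h; rewrite !inE; case: (altP (h =P v)) => [->|nhv] /=.
      by case: ifP; rewrite !inE ?eqxx ?(negbTE vH).
    by case: ifP; rewrite !inE ?(negbTE nhv).
  rewrite /= /bump; case: ltnP => [ltvx|]; last first.
    rewrite leq_eqVlt => /orP[/eqP/val_inj e|ltxv]; first by rewrite e eqxx in xv.
    rewrite set0U ci leqNgt -[X in (X < q)%N]ci proper_card //.
    rewrite properE; apply/andP; split.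
      by apply/subsetP => h; rewrite !inE => /andP[-> /= /ltn_trans->].
    by apply/subsetPn; exists x; rewrite !inE ?xH ?ltnn.
  rewrite cardsU1 inE (negbTE vH) /= ci.
  have -> // : (q <= i)%N.
  rewrite -ci subset_leq_card //; apply/subsetP => h; rewrite !inE => /andP[-> /= lt].
  exact: ltn_trans ltvx.
rewrite minorE (expand_det_col _ Q) mxE mulr_sumr; apply: eq_bigr => a _.
rewrite !mxE eQ [RHS]mulrCA; congr (_ * _).
rewrite /cofactor add0n exprD [_ ^+ a * _]mulrC -mulrA; congr (_ * (_ * _)).
rewrite -det_tr; congr (\det _); apply/matrixP => i j; rewrite !mxE eL.
case: splitP => [l|l] /= e; first by have := ltn_ord l; rewrite -e.
have -> : l = i by apply/val_inj; move: e; rewrite /bump /= add1n => -[].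
by rewrite !mxE (nth_ecol cH).
Qed.

End Card.
End Cofactor.

(** * Sign obstruction from nonnegative minors *)

Section Crossing.
Variables (F : realFieldType) (k n : nat) (A : 'M[F]_(k.+1, n)).
Hypothesis A_ge0 : forall S : {set 'I_n}, #|S| = k.+1 -> 0 <= minor A S.

(* Under the other hypotheses the four minors would satisfy
   [minor(x,d) minor(w,m) = - minor(w,d) minor(x,m)]. *)
Lemma crossing (G : {set 'I_n}) (x d w m : 'I_n) :
  (x < d)%N -> (d < w)%N -> (w < m)%N ->
  x \notin G -> d \notin G -> w \notin G -> m \notin G ->
  minor A (x |: (d |: G)) != 0 -> minor A (w |: (d |: G)) != 0 ->
  minor A (x |: (m |: G)) != 0 -> minor A (w |: (m |: G)) != 0 ->
  (rsp A^T (d |: G) :=: rsp A^T (m |: G))%MS -> False.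
Proof.
move=> xd dw wm xG dG wG mG Mxd Mwd Mxm Mwm edm.
have neq (a b : 'I_n) : (a < b)%N -> (a == b) = false.
  by move=> lt; apply/negbTE/eqP => e; move: lt; rewrite e ltnn.
have xw := ltn_trans xd dw; have xm := ltn_trans xw wm.
have xdG : x \notin d |: G by rewrite !inE neq.
have wdG : w \notin d |: G by rewrite !inE eq_sym neq.
have xmG : x \notin m |: G by rewrite !inE neq.
have wmG : w \notin m |: G by rewrite !inE neq.
have cd : #|d |: G| = k.
  by move: Mxd; rewrite minor_neq0 [in X in X -> _]cardsU1 xdG => /andP[/eqP[]].
have cm : #|m |: G| = k.
  by move: Mxm; rewrite minor_neq0 [in X in X -> _]cardsU1 xmG => /andP[/eqP[]].
have idG : indep A^T (d |: G).
  apply: indepS (subsetUr [set x] _) _; move: Mxd.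
  by rewrite minor_neq0 /indep => /andP[/eqP -> ->].
pose fd v := (row v A^T *m kap A (d |: G)) 0 0.
pose fm v := (row v A^T *m kap A (m |: G)) 0 0.
(* The forms [fd] and [fm] vanish on the same hyperplane, hence are proportional. *)
have rel : fd x * fm w = fd w * fm x.
  pose u := fd x *: row w A^T - fd w *: row x A^T.
  have uE (M : 'cV_k.+1) : (u *m M) 0 0 =
      fd x * (row w A^T *m M) 0 0 - fd w * (row x A^T *m M) 0 0.
    rewrite /u mulmxBl -!scalemxAl; move: (row w A^T *m M) (row x A^T *m M) => P Q.
    by rewrite !mxE.
  have /(kap_rsp cm)/matrixP/(_ 0 0) : (u <= rsp A^T (m |: G))%MS.
    rewrite -edm -kap_eq0 //; apply/eqP/matrixP => i j.
    by rewrite (ord1 i) (ord1 j) uE [RHS]mxE -/(fd x) -/(fd w) mulrC subrr.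
  by rewrite uE [RHS]mxE => /subr0_eq.
have gt0 S : minor A S != 0 -> 0 < minor A S.
  move=> nz; rewrite lt_neqAle eq_sym nz A_ge0 //.
  by move: nz; rewrite minor_neq0 => /andP[/eqP].
have cnt (a v : 'I_n) : a \notin G ->
    #|[set h in a |: G | (h < v)%N]| = ((a < v) + #|[set h in G | (h < v)%N]|)%N.
  move=> aG; case: (boolP (a < v)%N) => lt.
    rewrite (_ : [set _ in _ | _] = a |: [set h in G | (h < v)%N]).
      by rewrite cardsU1 inE (negbTE aG).
    apply/setP => h; rewrite !inE; case: eqP => [->|] //=; by rewrite lt.
  rewrite add0n; congr #|pred_of_set _|; apply/setP => h; rewrite !inE.
  by case: eqP => [->|] //=; rewrite (negbTE lt) (negbTE aG).
have sx : (m < x)%N = false by rewrite ltnNge ltnW.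
have sw : (m < w)%N = false by rewrite ltnNge ltnW.
have sd : (d < x)%N = false by rewrite ltnNge ltnW.
have E1 := minorU1 A cd xdG; have E2 := minorU1 A cd wdG.
have E3 := minorU1 A cm xmG; have E4 := minorU1 A cm wmG.
(* The signs coming from [G] agree in both products; among [d] and [m] only [d < w] contributes one
   more. *)
rewrite cnt // -/(fd x) sd add0n in E1; rewrite cnt // -/(fd w) dw add1n exprS in E2.
rewrite cnt // -/(fm x) sx add0n in E3; rewrite cnt // -/(fm w) sw add0n in E4.
have h14 := mulr_gt0 (gt0 _ Mxd) (gt0 _ Mwm).
have h23 := mulr_gt0 (gt0 _ Mwd) (gt0 _ Mxm).
have : minor A (x |: (d |: G)) * minor A (w |: (m |: G)) =
    - (minor A (w |: (d |: G)) * minor A (x |: (m |: G))).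
  rewrite E1 E2 E3 E4 !mulN1r !mulNr opprK mulrACA rel.
  by rewrite [RHS]mulrACA; congr (_ * _); apply: mulrC.
by move=> e; move: h14; rewrite e oppr_gt0 => /(lt_trans h23); rewrite ltxx.
Qed.

End Crossing.

(** * Separation in positroids *)

Section Exchange.
Variables (F : fieldType) (p k : nat) (M : 'M[F]_(p, k)).
Implicit Types (L J Y : {set 'I_p}).

Lemma rspU1_exchange L Y u v : L \subset Y ->
  (rsp M (u |: L) :=: rsp M (v |: L))%MS -> (rsp M (u |: Y) :=: rsp M (v |: Y))%MS.
Proof.
move=> LY e; have E i : i |: Y = (i |: L) :|: Y by rewrite -setUA (setUidPr LY).
apply/eqmxP; rewrite !E; apply/andP; split.
  by rewrite !rspU (adds_eqmx e (eqmx_refl _)).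
by rewrite !rspU (adds_eqmx e (eqmx_refl _)).
Qed.

(** Enlarge [L] inside [J] one element at a time; the element [x] whose addition first captures [v]
    can be exchanged with [v] over the set reached just before. *)
Lemma exchange L J v : L \subset J ->
  ~~ (row v M <= rsp M L)%MS -> (row v M <= rsp M J)%MS ->
  exists x (L' : {set 'I_p}), [/\ L \subset L', L' \subset J, x \in J :\: L',
    ~~ (row v M <= rsp M L')%MS & (rsp M (x |: L') :=: rsp M (v |: L'))%MS].
Proof.
have [q] := ubnP #|J :\: L|; elim: q L => // q IH L ltq LJ vL vJ.
have [x xJL] : exists x, x \in J :\: L.
  apply/set0Pn; apply: contra vL; rewrite setD_eq0 => JL.
  exact: submx_trans vJ (rspS _ JL).
have [xL xJ] : x \notin L /\ x \in J by move: xJL; rewrite inE => /andP[].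
case: (boolP (row v M <= rsp M (x |: L))%MS) => vxL.
  exists x, L; split=> //; apply: eqmx_sym; apply/eqmxP.
  have sub : (rsp M (v |: L) <= rsp M (x |: L))%MS.
    apply/rsp_subP => i; rewrite !inE => /orP[/eqP -> //|iL].
    by apply: row_rsp; rewrite !inE iL orbT.
  rewrite sub /=; have [_ <-] := mxrank_leqif_sup sub.
  rewrite eqn_leq mxrankS //= -/(rk M (x |: L)) -/(rk M (v |: L)) !rkU1 vL.
  by rewrite leq_add2l leq_b1.
have [||||x' [L' [LL' ? ? ? ?]]] := IH (x |: L); last first.
- by exists x', L'; split=> //; apply: subset_trans LL'; apply: subsetUr.
- by [].
- by [].
- by rewrite subUset sub1set xJ.
- move: ltq; rewrite (cardsD1 x) xJL ltnS; apply: leq_ltn_trans.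
  by rewrite subset_leq_card //; apply/subsetP => i; rewrite !inE negb_or -andbA.
Qed.

End Exchange.

(** * Splitting of the contraction by a set whose closure contains [m] *)

Section Separation.
Variables (F : realFieldType) (k n : nat) (A : 'M[F]_(k.+1, n)).
Hypothesis A_ge0 : forall S : {set 'I_n}, #|S| = k.+1 -> 0 <= minor A S.
Hypothesis rA : \rank A = k.+1.

(** If the ranks did not add up, some basis would contain [x < d] and allow the exchanges of [d] for
    [m] and of [x] for some [w] with [d < w < m]. The four resulting bases contradict [crossing]. *)
Lemma separation (m y0 y1 : 'I_n) (T : {set 'I_n}) :
  (forall j, j \in T -> (j < m)%N) -> y0 \notin T -> y1 \notin T ->
  (row m A^T <= rsp A^T T)%MS ->
  ~~ (row m A^T <= rsp A^T [set j in T | (j < y0)%N || (y1 < j)%N])%MS ->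
  exists2 d : 'I_n, (y0 < d < y1)%N /\ d \in T &
    let X1 := [set j : 'I_n | (j \notin T) && (j < d)%N] in
    let X2 := [set j : 'I_n | (j \notin T) && (d < j < m)%N] in
    (rk A^T (T :|: X1 :|: X2) + rk A^T T = rk A^T (T :|: X1) + rk A^T (T :|: X2))%N.
Proof.
move=> Tm y0T y1T mT; set To := [set _ in _ | _] => mTo.
have ToT : To \subset T by apply/subsetP => i; rewrite inE => /andP[].
have [I' [I'To iI' rI']] := basis_exists A^T To.
have [I [I'I IT iI rI]] := indep_extend (subset_trans I'To ToT) iI'.
have eI := rsp_eq IT rI; have eI' := rsp_eq I'To rI'.
(* [m] depends on [I] but not on [I'], so it can replace some [d] in [I] outside [I']. This [d] is
   not in [To], hence lies between [y0] and [y1]. *)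
have [||d [L1 [I'L1 L1I /setDP[dI dL1] mL1 edm]]] := @exchange _ _ _ A^T I' I m I'I.
- by rewrite eI'.
- by rewrite eI.
have dT : d \in T by apply: (subsetP IT).
have dTo : d \notin To.
  apply/negP => /(row_rsp A^T); rewrite -eI' => dI'.
  have dI'' : d \notin I' by apply: contra dL1; apply: (subsetP I'L1).
  have : indep A^T (d |: I') by apply: indepS iI; rewrite subUset sub1set dI.
  by rewrite indepU1 // dI'.
exists d.
  split=> //; move: dTo; rewrite inE dT /= negb_or -!leqNgt => /andP[].
  have neq (y : 'I_n) : y \notin T -> (y : nat) <> d.
    by move=> yT /val_inj e; rewrite e dT in yT.
  by move: (neq _ y0T) (neq _ y1T); clear; lia.
move=> X1 X2; apply/eqP; rewrite eqn_leq; apply/andP; split.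
  have -> : T :|: X1 :|: X2 = (T :|: X1) :|: (T :|: X2) by rewrite setUACA setUid setUA.
  have eT : (T :|: X1) :&: (T :|: X2) = T.
    rewrite -setUIr (_ : X1 :&: X2 = set0) ?setU0 //.
    by apply/setP => j; rewrite !inE; case: ltngtP; rewrite ?andbF.
  by have := rk_submod A^T (T :|: X1) (T :|: X2); rewrite eT.
rewrite leqNgt; apply/negP => lt.
have [J1 [IJ1 J1T iJ1 rJ1]] := indep_extend (subset_trans IT (subsetUl T X1)) iI.
have [J [J1J JT iJ rJ]] := indep_extend (subset_trans J1T (subsetUl _ X2)) iJ1.
have eJ1 := rsp_eq J1T rJ1.
have eJ := rsp_eq JT rJ.
(* By the strict inequality [L] is too small to span [T :|: X2], which yields [w] in [X2] outside
   its span. Since [J] does span [w], an exchange then finds [x] in [J1] outside [I], hence in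
   [X1]. *)
pose L := I :|: (J :\: J1).
have JX2 j : j \in J :\: J1 -> j \in X2.
  move=> /setDP[jJ jJ1]; have := subsetP JT _ jJ; rewrite inE => /orP[jT|//].
  have : indep A^T (j |: J1) by apply: indepS iJ; rewrite subUset sub1set jJ.
  by rewrite indepU1 // eJ1 row_rsp.
have iL : indep A^T L.
  apply: indepS iJ; rewrite subUset subsetDl andbT; exact: subset_trans J1J.
have cL : (#|L| < rk A^T (T :|: X2))%N.
  apply: leq_ltn_trans (_ : #|I| + #|J :\: J1| < _)%N; first by rewrite cardsU leq_subr.
  have := cardsID J1 J; rewrite (setIidPr J1J) -(eqP iJ) -(eqP iJ1) -(eqP iI).
  move: lt; rewrite rI rJ1 rJ; move: (rk A^T (T :|: X1 :|: X2)) (rk A^T (T :|: X1)).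
  by move: (rk A^T (T :|: X2)) (rk A^T T) #|J :\: J1|; clear; lia.
have IL : I \subset L by apply: subsetUl.
have LJ : L \subset J by rewrite subUset (subset_trans IJ1 J1J) subsetDl.
have [w wTX wL] : exists2 w, w \in T :|: X2 & ~~ (row w A^T <= rsp A^T L)%MS.
  apply: contrapT => no; have : (rsp A^T (T :|: X2) <= rsp A^T L)%MS.
    by apply/rsp_subP => i iT; apply/negPn/negP => nl; apply: no; exists i.
  by move/mxrankS; rewrite leqNgt -/(rk _ L) (eqP iL) cL.
have notI v : v \in T -> (row v A^T <= rsp A^T I)%MS by rewrite eI; apply: row_rsp.
have wX2 : w \in X2.
  move: wTX; rewrite inE => /orP[/notI wI|//].
  by rewrite (submx_trans wI (rspS _ IL)) in wL.
have wJ : (row w A^T <= rsp A^T J)%MS by rewrite eJ row_rsp // in_setU wX2 orbT.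
have [x [L2 [LL2 L2J /setDP[xJ xL2] wL2 exw]]] := exchange LJ wL wJ.
have xX1 : x \in X1.
  have xL : x \notin L by apply: contra xL2; apply: (subsetP LL2).
  move: xL; rewrite !inE negb_or xJ andbT negbK => /andP[xI xJ1].
  have := subsetP J1T _ xJ1; rewrite inE => /orP[xT|]; last by rewrite inE.
  have : indep A^T (x |: I) by apply: indepS iJ; rewrite subUset sub1set xJ (subset_trans IL).
  by rewrite indepU1 // notI.
have [b [Jb _ ib rb]] := indep_extend (subsetT J) iJ.
have rk_b : rk A^T b = k.+1 by rewrite rb rk_setT.
have [xT xd] : x \notin T /\ (x < d)%N by move: xX1; rewrite inE => /andP[].
have [wT dw wm] : [/\ w \notin T, (d < w)%N & (w < m)%N].
  by move: wX2; rewrite inE => /and3P[].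
have xb : x \in b by apply: (subsetP Jb).
have db : d \in b by apply: (subsetP Jb); apply: (subsetP LJ); apply: (subsetP IL).
have nxd : x != d by apply: contraTneq xd => ->; rewrite ltnn.
(* Both exchanges remain valid over the rest of the basis, because [L1] lies in [G] and [L2] in
   [d |: G]. *)
pose G := b :\ x :\ d.
have dG : d |: G = b :\ x by rewrite setD1K // !inE eq_sym nxd.
have xG : x |: G = b :\ d.
  by apply/setP => i; rewrite !inE; case: (altP (i =P x)) => [->|] //=; rewrite nxd xb.
have b1 : x |: (d |: G) = b by rewrite dG setD1K.
have cb : k.+1 = (#|G|.+2)%N.
  rewrite -rk_b (eqP ib) (cardsD1 x b) xb (cardsD1 d (b :\ x)).
  by rewrite !inE eq_sym nxd db.
have L1G : L1 \subset G.
  apply/subsetP => i iL1; rewrite !inE; have iI1 := subsetP L1I _ iL1.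
  rewrite (subsetP Jb _ (subsetP LJ _ (subsetP IL _ iI1))) andbT.
  apply/andP; split; first by apply: contraNneq dL1 => <-.
  by apply: contraNneq xT => <-; apply: (subsetP IT).
have L2G : L2 \subset d |: G.
  rewrite dG; apply/subsetP => i iL2; rewrite !inE (subsetP Jb _ (subsetP L2J _ iL2)) andbT.
  by apply: contraNneq xL2 => <-.
have edmG := rspU1_exchange L1G edm.
have exwG := rspU1_exchange L2G exw.
have rkU1_eq v Y Y' : (rsp A^T Y :=: rsp A^T Y')%MS -> rk A^T (v |: Y) = rk A^T (v |: Y').
  by move=> e; rewrite /rk !rspU (adds_eqmx (eqmx_refl _) e).
have r1 : rk A^T (x |: (d |: G)) = k.+1 by rewrite b1.
have r2 : rk A^T (w |: (d |: G)) = k.+1 by apply: etrans r1; rewrite /rk exwG.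
have r3 : rk A^T (x |: (m |: G)) = k.+1 by apply: etrans r1; apply/esym/rkU1_eq.
have r4 : rk A^T (w |: (m |: G)) = k.+1 by apply: etrans r2; apply/esym/rkU1_eq.
have card2 u v : rk A^T (u |: (v |: G)) = k.+1 ->
    [/\ #|u |: (v |: G)| = k.+1, u \notin G & v \notin G].
  move=> r; have := rk_card A^T (u |: (v |: G)); rewrite r [in k.+1]cb !cardsU1 in_setU1.
  by case: (u \in G); case: (v \in G); case: (u == v) => //=; clear; lia.
have M u v : rk A^T (u |: (v |: G)) = k.+1 -> minor A (u |: (v |: G)) != 0.
  by move=> r; have [c _ _] := card2 u v r; rewrite minor_neq0 r c eqxx.
have [_ xG' dG'] := card2 _ _ r1; have [_ wG' mG'] := card2 _ _ r4.
exact: (crossing A_ge0 xd dw wm xG' dG' wG' mG' (M _ _ r1) (M _ _ r2) (M _ _ r3) (M _ _ r4)).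
Qed.

End Separation.

(** * Expected codimension as a Möbius sum *)

Section SubsetSums.
Variables (T : finType).
Implicit Types (S U Y Z : {set T}) (F g : {set T} -> int).

Lemma sum_subsetU1 y S F : y \notin S ->
  \sum_(Z : {set T} | Z \subset y |: S) F Z =
  \sum_(Z : {set T} | Z \subset S) F Z + \sum_(Z : {set T} | Z \subset S) F (y |: Z).
Proof.
move=> yS; rewrite (bigID (fun Z => y \in Z)) /= addrC; congr (_ + _).
  apply: eq_bigl => Z; apply/andP/idP => [[ZS yZ]|ZS].
    apply/subsetP => z zZ; have := subsetP ZS z zZ; rewrite !inE => /orP[/eqP e|//].
    by rewrite -e zZ in yZ.
  by rewrite (subset_trans ZS (subsetUr _ _)); split=> //; apply: contra yS; apply: subsetP.
rewrite (reindex_onto (fun Z => y |: Z) (fun Z => Z :\ y)) /=; last first.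
  by move=> Z /andP[_ yZ]; rewrite setD1K.
apply: eq_bigl => Z; rewrite setU11 andbT; apply/andP/idP => [[ZS /eqP e]|ZS].
  apply/subsetP => z zZ; have := subsetP ZS z; rewrite !inE zZ orbT => /(_ isT).
  by move=> /orP[/eqP ez|//]; move: zZ; rewrite -e ez !inE eqxx.
split; first exact: setUS.
by rewrite setU1K //; apply: contra yS; apply: subsetP.
Qed.

(** Adding or removing [y] is a sign-reversing involution. *)
Lemma alternating_sum0 y Y g : y \in Y ->
  (forall Z, Z \subset Y -> y \notin Z -> g (y |: Z) = g Z) ->
  \sum_(Z : {set T} | Z \subset Y) (-1) ^+ #|Z| * g Z = 0.
Proof.
move=> yY gE; rewrite -(setD1K yY) sum_subsetU1 ?setD11 // -big_split /=.
apply: big1 => Z ZY; have yZ : y \notin Z.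
  by apply/negP => /(subsetP ZY); rewrite setD11.
rewrite gE //; last exact: subset_trans ZY (subD1set _ _).
by rewrite cardsU1 yZ exprS mulN1r mulNr subrr.
Qed.

Variables (E : {set T}) (rho : {set T} -> int).

(** Möbius inversion of [rho] over the supersets in [E]. The condition on [S] is an indicator
    factor, so that [alternating_sum0] applies to the sum over all subsets of [E]. *)
Definition upper_mobius Z : int :=
  (-1) ^+ #|Z| * \sum_(S : {set T} | S \subset E) (-1) ^+ #|S| * ((Z \subset S)%:R * rho S).

(** After exchanging the sums, the coefficient of [rho S] is an alternating sum over the interval
    from [U] to [S], which cancels unless [S = U]. *)
Lemma upper_mobiusK U : U \subset E ->
  \sum_(Z : {set T} | Z \subset E) (U \subset Z)%:R * upper_mobius Z = rho U.
Proof.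
move=> UE; under eq_bigr do rewrite /upper_mobius !mulr_sumr.
rewrite exchange_big /= (bigD1 U) //= [X in _ + X]big1 ?addr0.
  rewrite (bigD1 U) //= subxx !mul1r mulrA -exprMn mulrN1 opprK expr1n mul1r.
  rewrite big1 ?addr0 // => Z /andP[_ ZU].
  case: (boolP (U \subset Z)) => UZ; last by rewrite mul0r.
  case: (boolP (Z \subset U)) => ZU'; last by rewrite !mul0r !mulr0.
  by move: ZU; rewrite eqEsubset ZU' UZ.
move=> S /andP[SE SU].
rewrite (eq_bigr (fun Z => ((-1) ^+ #|S| * rho S) *
  ((-1) ^+ #|Z| * ((U \subset Z) && (Z \subset S))%:R))); last first.
  move=> Z _; case: (U \subset Z); case: (Z \subset S);
    rewrite /= ?(mulr0n, mulr1n, mulr0, mul0r, mulr1, mul1r) //.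
  by rewrite mulrC.
rewrite -mulr_sumr; apply/eqP; rewrite mulf_eq0; apply/orP; right; apply/eqP.
transitivity (\sum_(Z : {set T} | Z \subset S) (-1) ^+ #|Z| * (U \subset Z)%:R : int).
  rewrite [LHS](bigID (fun Z => Z \subset S)) /= [X in _ + X]big1 ?addr0.
    apply: eq_big => [Z|Z /andP[_ ->]]; last by rewrite andbT.
    by apply/andP/idP => [[]//|ZS]; rewrite (subset_trans ZS).
  by move=> Z /andP[_ /negbTE ->]; rewrite andbF mulr0.
case: (boolP (U \subset S)) => US; last first.
  by apply: big1 => Z ZS; case: (boolP (U \subset Z)) => UZ; rewrite ?mulr0 //;
    rewrite (subset_trans UZ ZS) in US.
have /subsetPn[y yS yU] : ~~ (S \subset U) by apply: contra SU => SU; rewrite eqEsubset SU.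
apply: (alternating_sum0 yS) => Z ZS yZ; congr (_%:R); congr nat_of_bool.
apply/subsetP/subsetP => sub u uU; have := sub u uU; rewrite !inE.
  by case/orP => // /eqP e; rewrite -e uU in yU.
by move=> ->; rewrite orbT.
Qed.

(** Moves the inversion from [alpha] to [rho], so that only the lower sums of [alpha] have to be
    known. *)
Lemma sum_by_upper_mobius alpha gam :
  (forall S, S \subset E -> \sum_(Z : {set T} | Z \subset S) alpha Z = gam S) ->
  \sum_(S : {set T} | S \subset E) rho S * alpha S =
  \sum_(S : {set T} | S \subset E) upper_mobius S * gam S.
Proof.
move=> ag; under eq_bigr => S SE do rewrite -(upper_mobiusK SE) mulr_suml.
rewrite exchange_big /=; apply: eq_bigr => Z ZE; rewrite -ag // mulr_sumr.
rewrite [LHS](bigID (fun S => S \subset Z)) /= [X in _ + X]big1 ?addr0.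
  apply: eq_big => [S|S /andP[_ ->]]; last by rewrite mul1r.
  by apply/andP/idP => [[]//|ZS]; rewrite (subset_trans ZS).
by move=> S /andP[_ /negbTE ->]; rewrite !mul0r.
Qed.

End SubsetSums.

(** * Expected dimension, column by column *)

Section ExpectedCodimension.
Variables (n : nat) (P : {set {set 'I_n}}).
Implicit Types (S T : {set 'I_n}).

Lemma mrk0 : mrk P set0 = 0%N.
Proof. by apply/eqP; rewrite -leqn0; apply/bigmax_leqP => b _; rewrite set0I cards0. Qed.

(** The recursion descends to proper subsets and gives 0 on the empty set with any fuel, so fuel
    beyond the cardinality changes nothing. *)
Lemma a_aux_fuel Sf f f' S : (#|S| <= f)%N -> (#|S| <= f')%N ->
  a_aux P Sf f S = a_aux P Sf f' S.
Proof.
have E0 f0 : a_aux P Sf f0 set0 = 0.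
  case: f0 => //= f0; rewrite /cS mrk0 cards0 subrr big1 ?subr0 // => T /andP[_].
  by move=> /proper_card; rewrite cards0.
elim: f f' S => [|f IH] [|f'] S.
- by [].
- by rewrite leqn0 cards_eq0 => /eqP -> _; rewrite !E0.
- by move=> _; rewrite leqn0 cards_eq0 => /eqP ->; rewrite !E0.
move=> Sf1 Sf2 /=; congr (_ - _); apply: eq_bigr => T /andP[_ /proper_card TS].
by apply: IH; rewrite -ltnS; apply: leq_trans TS _.
Qed.

Definition acoef S : int := a_fam P [set: {set 'I_n}] S.

Lemma sum_acoef S : \sum_(T : {set 'I_n} | T \subset S) acoef T = cS P S.
Proof.
rewrite (bigD1 S) //= /acoef {1}/a_fam; case E : #|S| => [|s].
  move/eqP: E; rewrite cards_eq0 => /eqP -> /=; rewrite add0r /cS mrk0 cards0 subrr.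
  apply: big1 => T /andP[T0 /negP[]]; by rewrite -subset0.
rewrite /= [X in _ - X + _](eq_bigr acoef) => [|T /andP[_ /proper_card]]; last first.
  by rewrite E ltnS => TS; apply: a_aux_fuel.
rewrite [X in _ - X + _](eq_bigl (fun T => (T \subset S) && (T != S))) ?subrK // => T.
by rewrite inE /= properEneq andbC.
Qed.

(** The number that has to be shown to be the dimension of the stratum in the Grassmannian. *)
Definition expdim : int :=
  \sum_(S : {set 'I_n}) (mrk P S)%:Z * acoef S.

Lemma ecE k : ec k P = k%:Z * (n%:Z - (mrk P setT)%:Z) - expdim.
Proof.
rewrite /ec /ec_fam (eq_bigr (fun S => k%:Z * acoef S - (mrk P S)%:Z * acoef S)).
  rewrite sumrB -mulr_sumr /expdim; congr (_ * _ - _).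
    rewrite (eq_bigl (fun T => T \subset setT)) => [|T]; last by rewrite inE subsetT.
    by rewrite sum_acoef /cS cardsT card_ord.
  by apply: eq_bigl => S; rewrite inE.
by move=> S _; rewrite mulrBl.
Qed.

Definition pre (m : nat) : {set 'I_n} := [set j : 'I_n | (j < m)%N].

Definition prefix_dim (m : nat) : int :=
  \sum_(S : {set 'I_n} | S \subset pre m) (mrk P S)%:Z * acoef S.

Lemma preS (m : 'I_n) : pre m.+1 = m |: pre m.
Proof. by apply/setP => j; rewrite !inE ltnS leq_eqVlt. Qed.

Lemma pre0 : pre 0 = set0.
Proof. by apply/setP => j; rewrite !inE. Qed.

Lemma notin_pre (m : 'I_n) : m \notin pre m.
Proof. by rewrite inE ltnn. Qed.

Lemma prefix_dim0 : prefix_dim 0 = 0.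
Proof.
rewrite /prefix_dim pre0 big1 // => S; rewrite subset0 => /eqP ->.
by rewrite mrk0 mul0r.
Qed.

Lemma prefix_dimn : prefix_dim n = expdim.
Proof.
apply: eq_bigl => S; apply/subsetP => j _; by rewrite inE ltn_ord.
Qed.

Lemma prefix_dimS (m : 'I_n) : prefix_dim m.+1 =
  prefix_dim m + \sum_(S : {set 'I_n} | S \subset pre m) (mrk P (m |: S))%:Z * acoef (m |: S).
Proof. by rewrite /prefix_dim preS sum_subsetU1 // notin_pre. Qed.

(** For a matroid the right-hand side is the indicator that [m] lies in the closure of [S]. *)
Lemma sum_acoefU1 (m : 'I_n) S : S \subset pre m ->
  \sum_(T : {set 'I_n} | T \subset S) acoef (m |: T) =
  1 + (mrk P S)%:Z - (mrk P (m |: S))%:Z.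
Proof.
move=> Sm; have mS : m \notin S by apply: contra (notin_pre m); apply: subsetP.
have := sum_acoef (m |: S); rewrite sum_subsetU1 // sum_acoef /cS cardsU1 mS => e.
apply: (addrI (#|S|%:Z - (mrk P S)%:Z)); rewrite e PoszD /=; ring.
Qed.

End ExpectedCodimension.

(** * Cyclic intervals around a column *)

(** The [b] satisfying both conditions form an interval, and a nonempty interval has one more point
    than it has pairs of neighbours. *)
Lemma count_interval (p q : nat -> bool) m :
  (forall b, p b.+1 -> p b) -> (forall b, q b -> q b.+1) ->
  (\sum_(b < m.+1) (p b && q b) =
   \sum_(b < m) (p b.+1 && q b) + [exists b : 'I_m.+1, p b && q b])%N.
Proof.
move=> dp uq; have ex k : [exists b : 'I_k.+1, p b && q b] = (\sum_(b < k.+1) (p b && q b) != 0)%N.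
  rewrite sum_nat_eq0 negb_forall; apply: eq_existsb => b.
  by rewrite /=; case: (_ && _).
have dpl b c : p (b + c)%N -> p b.
  by elim: c => [|c IH]; rewrite ?addn0 // addnS => /dp.
have uql b c : q b -> q (b + c)%N.
  by elim: c => [|c IH]; rewrite ?addn0 // addnS => /IH/uq.
elim: m => [|m IH]; first by rewrite ex !big_ord_recr !big_ord0 /=; case: (_ && _).
rewrite ex big_ord_recr [in X in _ = (X + _)%N]big_ord_recr /=.
have sq : ~~ q m -> (\sum_(b < m.+1) (p b && q b) = 0)%N.
  move=> qm; apply: big1 => b _; rewrite [q b](contraNF _ qm) ?andbF // => qb.
  have : (b <= m)%N by rewrite -ltnS.
  by move/subnKC => <-; apply: uql.
have sp : p m.+1 -> q m -> (0 < \sum_(b < m.+1) (p b && q b))%N.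
  by move=> pm qm; rewrite big_ord_recr /= dp // qm addn1.
move: IH sq sp; rewrite ex; move: (\sum_(b < m.+1) _)%N (\sum_(b < m) _)%N => s s' e sq sp.
case: (boolP (p m.+1)) sp => pm sp /=; last by rewrite !addn0.
case: (boolP (q m)) sq sp => qm sq sp /=.
  by have := sp isT isT; rewrite uq //; move: e; clear; case: s => // s; lia.
by rewrite sq // in e *; move: e; clear; case: (q _) => /=; lia.
Qed.

(** * The staircase of minimal spanning arcs *)

Section Staircase.
Variables (n : nat) (r : {set 'I_n} -> nat) (m : 'I_n).
Implicit Types (S T U : {set 'I_n}).

Hypothesis r_mono : forall S T, S \subset T -> (r S <= r T)%N.
Hypothesis r_submod : forall S T, (r (S :|: T) + r (S :&: T) <= r S + r T)%N.

Definition spans T := r (m |: T) == r T.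

Definition separated := forall (y0 y1 : 'I_n) T,
  (forall j, j \in T -> (j < m)%N) -> y0 \notin T -> y1 \notin T -> spans T ->
  ~~ spans [set j in T | (j < y0)%N || (y1 < j)%N] ->
  exists2 d : 'I_n, (y0 < d < y1)%N /\ d \in T &
    let X1 := [set j : 'I_n | (j \notin T) && (j < d)%N] in
    let X2 := [set j : 'I_n | (j \notin T) && (d < j < m)%N] in
    (r (T :|: X1 :|: X2) + r T = r (T :|: X1) + r (T :|: X2))%N.

Hypothesis r_separation : separated.

Lemma spansS S T : S \subset T -> spans S -> spans T.
Proof.
move=> ST /eqP e; rewrite /spans eqn_leq [X in _ && X]r_mono ?subsetUr // andbT.
have := r_submod T (m |: S); rewrite setUCA (setUidPl ST) e.
have := @r_mono S (T :&: (m |: S)); rewrite subsetI ST subsetUr => /(_ isT).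
move: (r _) (r (_ :&: _)) (r (m |: T)) (r T); clear; lia.
Qed.

(* Complements in [pre m] of intervals, i.e. the cyclic intervals that surround [m]. *)
Definition arc (a b : nat) : {set 'I_n} :=
  [set j : 'I_n | (j < m)%N && ((a <= j)%N || (j < b)%N)].

Lemma arcS a a' b b' : (a' <= a)%N -> (b <= b')%N -> arc a b \subset arc a' b'.
Proof.
move=> aa bb; apply/subsetP => j; rewrite !inE => /andP[-> /orP[h|h]] /=.
  by rewrite (leq_trans aa h).
by rewrite (leq_trans h bb) orbT.
Qed.

Lemma arc_sub a b : arc a b \subset pre n m.
Proof. by apply/subsetP => j; rewrite !inE => /andP[]. Qed.

(** A larger [a] gives a smaller arc, so [sarc b] is the smallest arc with left part [[0, b)] whose
    closure contains [m]. The maximum is over a nonempty set once the whole prefix spans [m]. *)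
Definition top b := (\max_(a < m.+1 | spans (arc a b)) a)%N.
Definition sarc b := arc (top b) b.

Hypothesis spans_pre : spans (pre n m).

Lemma arc0 b : arc 0 b = pre n m.
Proof. by apply/setP => j; rewrite !inE leq0n andbT. Qed.

Lemma spans_sarc b : spans (sarc b).
Proof.
rewrite /sarc /top; have [|a sa ->] := @eq_bigmax_cond _ (fun a : 'I_m.+1 => spans (arc a b)) (fun a => nat_of_ord a).
  by apply/card_gt0P; exists ord0; rewrite unfold_in arc0.
exact: sa.
Qed.

Lemma top_max a b : (a <= m)%N -> spans (arc a b) -> (a <= top b)%N.
Proof.
rewrite -ltnS => am sa.
exact: (@leq_bigmax_cond _ (fun a : 'I_m.+1 => spans (arc a b)) (fun a => nat_of_ord a) (Ordinal am)).
Qed.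

Lemma top_le b : (top b <= m)%N.
Proof. by apply/bigmax_leqP => a _; rewrite -ltnS. Qed.

Lemma top_mono b : (top b <= top b.+1)%N.
Proof.
by apply: top_max (top_le b) _; apply: spansS (spans_sarc b); apply: arcS.
Qed.

(** Since [top] is monotone, the union is again an arc. The first condition gets stronger with [b]
    and the second weaker, as [count_interval] requires. *)
Lemma sarcU b T : (sarc b :|: sarc b.+1 \subset T) =
  ([set j in pre n m | (j < b.+1)%N] \subset T) && ([set j in pre n m | (top b <= j)%N] \subset T).
Proof.
rewrite -[RHS]subUset; suff -> : sarc b :|: sarc b.+1 = [set j in pre n m | (j < b.+1)%N]
    :|: [set j in pre n m | (top b <= j)%N] by [].
apply/setP => j; rewrite !inE.
have := top_mono b; case: (j < m)%N => //=; move: (top b) (top b.+1) (nat_of_ord j).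
by clear; lia.
Qed.

Lemma sarcE b T : (sarc b \subset T) =
  ([set j in pre n m | (j < b)%N] \subset T) && ([set j in pre n m | (top b <= j)%N] \subset T).
Proof.
rewrite -[RHS]subUset; suff -> : sarc b = [set j in pre n m | (j < b)%N]
    :|: [set j in pre n m | (top b <= j)%N] by [].
apply/setP => j; rewrite !inE.
by case: (j < m)%N => //=; rewrite orbC.
Qed.

Lemma sarc_m : sarc m = pre n m.
Proof. by apply/setP => j; rewrite !inE; case: ltnP; rewrite ?orbT. Qed.

(** Compare [T] with the arc outside its extreme gaps: either that arc spans [m] and contains a step
    of the staircase, or the separation property splits the complement of [T]. *)
Lemma spans_dichotomy T : T \subset pre n m -> spans T ->
  (exists b : 'I_m.+1, sarc b \subset T) \/
  exists T1 T2, [/\ T1 :|: T2 = pre n m, T1 :&: T2 = T, T \proper T1, T \proper T2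
     & (r (pre n m) + r T = r T1 + r T2)%N].
Proof.
move=> Tm sT; case: (boolP [exists b : 'I_m.+1, sarc b \subset T]) => [/existsP|noarc].
  by left.
right; have [y yT] : exists y, y \in pre n m :\: T.
  apply/set0Pn; rewrite setD_eq0; apply: contra noarc => mT; apply/existsP.
  by exists ord_max; rewrite sarc_m.
(* [y0] and [y1] are the first and the last column of the prefix missing from [T]. *)
have [y0 y0Y min0] := @arg_minnP _ y (mem (pre n m :\: T)) (fun j : 'I_n => nat_of_ord j) yT.
have [y1 y1Y max1] := @arg_maxnP _ y (mem (pre n m :\: T)) (fun j : 'I_n => nat_of_ord j) yT.
have [[y0T y0m] [y1T y1m]] : (y0 \notin T /\ (y0 < m)%N) /\ (y1 \notin T /\ (y1 < m)%N).
  by move: y0Y y1Y; rewrite !inE => /andP[-> ->] /andP[-> ->].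
have Tlt j : j \in T -> (j < m)%N by move=> jT; have := subsetP Tm j jT; rewrite inE.
have [|d [/andP[y0d dy1] dT] add] := r_separation Tlt y0T y1T sT.
  (* If the part of [T] outside [[y0, y1]] spans [m], maximality of [top] puts [sarc y0] inside
     [T]. *)
  apply: contra noarc => so; apply/existsP.
  have lt0 : (y0 < m.+1)%N by rewrite ltnW.
  have sub : arc y1.+1 y0 \subset T.
    apply/subsetP => j; rewrite inE => /andP[jm out]; apply/negPn/negP => jT.
    have jY : j \in pre n m :\: T by rewrite !inE jT.
    have := min0 j jY; have := max1 j jY; move: out; clear; lia.
  exists (Ordinal lt0); apply: subset_trans sub; apply: arcS => //=.
  apply: top_max => //; apply: spansS so; apply/subsetP => j.
  by rewrite !inE => /andP[/Tlt -> h]; rewrite orbC.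
set X1 := [set j | _] in add; set X2 := [set j | (_ \notin _) && (_ < _ < _)%N] in add.
have disj : X1 :&: X2 = set0.
  by apply/setP => j; rewrite !inE; case: ltngtP; rewrite ?andbF.
have union : T :|: X1 :|: X2 = pre n m.
  apply/setP => j; rewrite !inE; case: (boolP (j \in T)) => [/Tlt -> //|jT] /=.
  have dm := Tlt d dT; case: (ltngtP j d) => [lt|lt|/val_inj e] /=.
  - by rewrite (ltn_trans lt dm).
  - by [].
  - by rewrite e dT in jT.
have y0X : y0 \in X1 by rewrite inE y0T.
have y1X : y1 \in X2 by rewrite inE y1T dy1.
exists (T :|: X1), (T :|: X2); split.
- by rewrite setUACA setUid setUA.
- by rewrite -setUIr disj setU0.
- by rewrite properE subsetUl; apply/subsetPn; exists y0; rewrite // in_setU y0X orbT.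
- by rewrite properE subsetUl; apply/subsetPn; exists y1; rewrite // in_setU y1X orbT.
- by rewrite -add union.
Qed.

(** Equality in submodularity is inherited by every set between the intersection and the union, by
    three submodular inequalities. *)
Lemma additive_restrict T1 T2 S : (r (T1 :|: T2) + r (T1 :&: T2) = r T1 + r T2)%N ->
  T1 :&: T2 \subset S -> S \subset T1 :|: T2 ->
  (r S + r (T1 :&: T2) = r (S :&: T1) + r (S :&: T2))%N.
Proof.
move=> add TS SU.
have h1 := r_submod (S :&: T1) (S :&: T2); have h2 := r_submod S T1.
have h3 := r_submod (S :|: T1) T2.
rewrite -setIUr (setIidPl SU) setIACA setIid (setIidPr TS) in h1.
have e1 : S :|: T1 :|: T2 = T1 :|: T2 by rewrite -setUA (setUidPr SU).
have h4 : (r (S :&: T2) <= r ((S :|: T1) :&: T2))%N.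
  by apply: r_mono; apply: setSI; apply: subsetUl.
rewrite e1 in h3; move: add h1 h2 h3 h4.
move: (r S) (r T1) (r T2) (r (S :&: T1)) (r (S :&: T2)) (r (T1 :&: T2)) (r (T1 :|: T2)).
move: (r (S :|: T1)) (r ((S :|: T1) :&: T2)); clear; lia.
Qed.

Let rho S : int := (r (m |: S))%:Z.

(** Above [T1 :&: T2] the rank is a sum of a function of [S :&: T1], one of [S :&: T2] and a
    constant. Each ignores some element outside [T1 :&: T2], so its alternating sum vanishes. *)
Lemma upper_mobius_additive T1 T2 : T1 :|: T2 = pre n m -> spans (T1 :&: T2) ->
  T1 :&: T2 \proper T1 -> T1 :&: T2 \proper T2 ->
  (r (pre n m) + r (T1 :&: T2) = r T1 + r T2)%N ->
  upper_mobius (pre n m) rho (T1 :&: T2) = 0.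
Proof.
set T := T1 :&: T2 => U sT /properP[TT1 [y1 y1T1 y1T]] /properP[TT2 [y2 y2T2 y2T]] add.
have y2T1 : y2 \notin T1 by apply: contra y2T => h; rewrite inE h.
have y1T2 : y1 \notin T2 by apply: contra y1T => h; rewrite inE y1T1.
rewrite /upper_mobius; apply/eqP; rewrite mulf_eq0; apply/orP; right; apply/eqP.
have E S : S \subset pre n m -> (T \subset S)%:R * rho S = (T \subset S)%:R * (r (S :&: T1))%:Z
    + (T \subset S)%:R * (r (S :&: T2))%:Z - (T \subset S)%:R * (r T)%:Z :> int.
  move=> Sm; case: (boolP (T \subset S)) => [TS|]; last by rewrite !mul0r addr0 subr0.
  have := @additive_restrict T1 T2 S; rewrite U -/T => /(_ add TS Sm).
  rewrite !mul1r /rho (eqP (spansS TS sT)) => e.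
  by apply/eqP; rewrite eq_sym subr_eq -!PoszD e.
under eq_bigr => S Sm do rewrite E // mulrBr mulrDr.
have tog y S : y \notin T -> (T \subset y |: S) = (T \subset S).
  move=> yT; apply/subsetP/subsetP => sub j jT; have := sub j jT; rewrite !inE.
    by case/orP => // /eqP e; rewrite -e jT in yT.
  by move=> ->; rewrite orbT.
have tgi y S T' : y \notin T' -> (y |: S) :&: T' = S :&: T'.
  move=> yT; apply/setP => j; rewrite !inE; case: (altP (j =P y)) => [->|//].
  by rewrite (negbTE yT) !andbF.
rewrite sumrB big_split /=.
rewrite (alternating_sum0 (y := y2)) ?(alternating_sum0 (y := y1)) ?addr0 ?subr0 //.
- by rewrite -U inE y1T1.
- by move=> S _ _; rewrite tog.
- by rewrite -U inE y1T1.
- by move=> S _ _; rewrite tog // tgi.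
- by rewrite -U inE y2T2 orbT.
- by move=> S _ _; rewrite tog // tgi.
Qed.

(** Both sides are combinations of the values of [upper_mobius]. At [Z] the left coefficient tells
    whether [Z] spans [m], the right one, by [count_interval], whether [Z] contains some [sarc b].
    Where they differ, [upper_mobius_additive] makes the value zero. *)
Lemma staircase_sum (alpha : {set 'I_n} -> int) :
  (forall S, S \subset pre n m ->
     \sum_(T : {set 'I_n} | T \subset S) alpha T = (spans S)%:R) ->
  \sum_(S : {set 'I_n} | S \subset pre n m) (r (m |: S))%:Z * alpha S =
  \sum_(b < m.+1) (r (sarc b))%:Z - \sum_(b < m) (r (sarc b :|: sarc b.+1))%:Z.
Proof.
move=> aE; rewrite (sum_by_upper_mobius rho aE).
have sm b : sarc b \subset pre n m by apply: arc_sub.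
have rs U : U \subset pre n m -> spans U -> (r U)%:Z =
    \sum_(Z : {set 'I_n} | Z \subset pre n m) (U \subset Z)%:R * upper_mobius (pre n m) rho Z.
  by move=> Um sU; rewrite upper_mobiusK // /rho (eqP sU).
have coll k (f : nat -> {set 'I_n}) : (forall b, f b \subset pre n m) ->
    (forall b, spans (f b)) -> \sum_(b < k) (r (f b))%:Z =
    \sum_(Z : {set 'I_n} | Z \subset pre n m)
      (\sum_(b < k) (f b \subset Z))%N%:R * upper_mobius (pre n m) rho Z.
  move=> fm fs; under eq_bigr do rewrite rs //.
  rewrite exchange_big /=; apply: eq_bigr => Z _.
  by rewrite natr_sum mulr_suml.
rewrite (coll _ sarc) //; last exact: spans_sarc.
rewrite (coll _ (fun b => sarc b :|: sarc b.+1)); first last.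
- by move=> b; apply: spansS (subsetUl _ _) (spans_sarc b).
- by move=> b; rewrite subUset !sm.
rewrite -sumrB; apply: eq_bigr => Z Zm; rewrite -mulrBl mulrC.
have cnt := @count_interval (fun b => [set j in pre n m | (j < b)%N] \subset Z)
     (fun b => [set j in pre n m | (top b <= j)%N] \subset Z) m.
under eq_bigr do rewrite sarcE.
under [X in _ - X%:R]eq_bigr do rewrite sarcU.
rewrite cnt; first last.
- move=> b; apply: subset_trans; apply/subsetP => j; rewrite !inE => /andP[-> h].
  exact: leq_trans (top_mono b) h.
- move=> b; apply: subset_trans; apply/subsetP => j; rewrite !inE => /andP[-> h].
  exact: leqW.
rewrite natrD addrAC subrr add0r; under eq_existsb do rewrite -sarcE.
case: existsP => [[b bZ]|no]; first by rewrite (spansS bZ (spans_sarc b)).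
case: (boolP (spans Z)) => sZ; last by rewrite !mul0r.
have [//|[T1 [T2 [U I p1 p2 add]]]] := spans_dichotomy Zm sZ.
by rewrite -I upper_mobius_additive ?mulr0 // I.
Qed.

End Staircase.

(** * The space of candidates for column [m] *)

Section ArcIntersection.
Variables (n : nat) (r : {set 'I_n} -> nat) (m : 'I_n).
Hypothesis r_mono : forall S T : {set 'I_n}, S \subset T -> (r S <= r T)%N.
Hypothesis r_submod : forall S T : {set 'I_n}, (r (S :|: T) + r (S :&: T) <= r S + r T)%N.
Hypothesis r_separation : separated r m.
Hypothesis spans_pre : spans r m (pre n m).

Variables (K : fieldType) (k : nat) (M : 'M[K]_(n, k)).
Hypothesis rM : forall T : {set 'I_n}, T \subset pre n m -> rk M T = r T.

Definition arc_cap c : 'M[K]_k := (\bigcap_(b < c.+1) rsp M (sarc r m b))%MS.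

Lemma top_monoW b c : (b <= c)%N -> (top r m b <= top r m c)%N.
Proof.
move/subnKC => <-; elim: (c - b)%N => [|i IH]; first by rewrite addn0.
by rewrite addnS; apply: leq_trans IH _; apply: top_mono.
Qed.

(** The dimension formula for an intersection, used inductively. The columns of [sarc c] from
    [top c] on lie in all earlier steps, the others lie in [sarc c.+1]; so [arc_cap c] and the next
    span together give the span of the union. *)
Lemma rank_arc_cap c : (\rank (arc_cap c))%:Z =
  \sum_(b < c.+1) (r (sarc r m b))%:Z - \sum_(b < c) (r (sarc r m b :|: sarc r m b.+1))%:Z.
Proof.
have sm b : sarc r m b \subset pre n m by apply: arc_sub.
elim: c => [|c IH].
  by rewrite /arc_cap !big_ord_recr !big_ord0 /= cap1mx -/(rk _ _) rM // add0r subr0.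
have := mxrank_sum_cap (arc_cap c) (rsp M (sarc r m c.+1)).
have <- : arc_cap c.+1 = (arc_cap c :&: rsp M (sarc r m c.+1))%MS.
  by rewrite /arc_cap [LHS]big_ord_recr.
rewrite -/(rk M (sarc r m c.+1)) rM //.
have -> : \rank (arc_cap c + rsp M (sarc r m c.+1))%MS = r (sarc r m c :|: sarc r m c.+1).
  rewrite -rM ?subUset ?sm //; apply: eqmx_rank; apply/andP; split.
    rewrite addsmx_sub; apply/andP; split; last by rewrite rspS ?subsetUr.
    apply: submx_trans (rspS M (subsetUl _ _)).
    exact: (bigcapmx_inf (ord_max : 'I_c.+1)).
  apply/rsp_subP => j; rewrite inE => /orP[jc|jc]; last first.
    by apply: submx_trans (addsmxSr _ _); apply: row_rsp.
  move: jc; rewrite inE => /andP[jm /orP[tj|jc]].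
    apply: submx_trans (addsmxSl _ _); apply/sub_bigcapmxP => b _; apply: row_rsp.
    rewrite inE jm (leq_trans _ tj) //; apply: top_monoW; by rewrite -ltnS.
  apply: submx_trans (addsmxSr _ _); apply: row_rsp; rewrite inE jm.
  by rewrite (ltn_trans jc) ?orbT.
move=> e; rewrite [X in _ = X - _]big_ord_recr [X in _ = _ - X]big_ord_recr /=.
rewrite opprD addrACA -IH; move: e.
move: (r (sarc _ _ c.+1)) (r (_ :|: _)) (\rank _) (\rank _) => u1 u2 u3 u4; clear; lia.
Qed.

(** Induction on the complement of [T]. In the split case additivity makes the span of [T] the
    intersection of the spans of the larger sets [T1] and [T2]. *)
Lemma arc_cap_sub (T : {set 'I_n}) : T \subset pre n m -> spans r m T -> (arc_cap m <= rsp M T)%MS.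
Proof.
have [q] := ubnP #|pre n m :\: T|; elim: q T => // q IH T ltq Tm sT.
have [[b bT]|[T1 [T2 [U I p1 p2 add]]]] :=
    spans_dichotomy r_mono r_submod r_separation Tm sT.
  by apply: submx_trans (rspS M bT); apply: (bigcapmx_inf b).
have step (T' : {set 'I_n}) : T \proper T' -> T' \subset pre n m -> (arc_cap m <= rsp M T')%MS.
  move=> TT' T'm; apply: IH => //; last first.
    exact: (spansS r_mono r_submod (proper_sub TT') sT).
  rewrite ltnS in ltq; apply: leq_trans ltq; apply: proper_card; have [sub [y yT' yT]] := properP TT'.
  apply/properP; split; first exact: setDS.
  by exists y; rewrite !inE ?yT' // (negbTE yT) /=; have := subsetP T'm y yT'; rewrite inE.
have [T1m T2m] : T1 \subset pre n m /\ T2 \subset pre n m by rewrite -U subsetUl subsetUr.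
have cap : (arc_cap m <= rsp M T1 :&: rsp M T2)%MS by rewrite sub_capmx !step.
apply: submx_trans cap _; have sub : (rsp M T <= rsp M T1 :&: rsp M T2)%MS.
  by rewrite sub_capmx !rspS // proper_sub.
have [_ <-] := mxrank_leqif_sup sub.
have := mxrank_sum_cap (rsp M T1) (rsp M T2).
rewrite -(rspU M T1 T2) U -!/(rk _ _) !rM // => e.
by apply/eqP; move: add e; clear; lia.
Qed.

End ArcIntersection.

(** * Charts of matrix sets *)

Section Completion.
Variables (K : fieldType) (q N : nat) (L : 'M[K]_(q, N)) (rho : nat).

(** The first [rho] rows are columns of [L] selected by [f], the others unit vectors selected by
    [ka]; there are finitely many choices. *)
Definition completion (f : {ffun 'I_q -> 'I_N}) (ka : {ffun 'I_q -> 'I_q}) : 'M[K]_q :=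
  \matrix_(i, a) if (i < rho)%N then L a (f i) else (a == ka i)%:R.

Lemma completion_exists (i0 : 'I_N) : \rank L = rho ->
  exists f ka, completion f ka \in unitmx.
Proof.
move=> rL; have [b0 [_ ib0 rb0]] := basis_exists L^T setT.
have eb0 := rsp_eq (subsetT b0) rb0.
have eT := rsp_setT L^T.
have cb0 : #|b0| = rho by rewrite -(eqP ib0) rb0 /rk eT mxrank_tr.
(* In the stacked matrix a basis among the columns of [L] extends to a full basis by unit
   vectors. *)
pose Q := col_mx L^T (1%:M : 'M[K]_q).
have rowl c : row (lshift q c) Q = row c L^T by rewrite rowKu.
have rowr c : row (rshift N c) Q = row c 1%:M by rewrite rowKd.
pose B0 := lshift q @: b0.
have eB0 : (rsp Q B0 :=: L^T)%MS.
  by apply: eqmx_trans eT; apply: eqmx_trans eb0; apply: rsp_imset.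
have iB0 : indep Q B0.
  by rewrite /indep /rk eB0 mxrank_tr rL card_imset ?cb0 //; apply: lshift_inj.
have [b [B0b _ ib rb]] := indep_extend (subsetT B0) iB0.
have rQ : rk Q setT = q.
  apply/eqP; rewrite eqn_leq rk_le /= -{1}(mxrank1 K q); apply: mxrankS.
  by apply/row_subP => c; rewrite -rowr row_rsp ?inE.
pose sg := [set a | rshift N a \in b].
have bl c : lshift q c \in b -> c \in b0.
  move=> cb; apply/negPn/negP => cb0'.
  have cB0 : lshift q c \notin B0.
    by apply: contra cb0' => /imsetP[c' c'b /lshift_inj ->].
  have : indep Q (lshift q c |: B0) by apply: indepS ib; rewrite subUset sub1set cb.
  by rewrite indepU1 // eB0 rowl row_sub.
have cb : (#|b0| + #|sg| = q)%N.
  rewrite -[RHS]rQ -rb (eqP ib) -(cardsID B0 b) (setIidPr B0b); congr (_ + _)%N.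
    by rewrite card_imset //; apply: lshift_inj.
  rewrite -(card_imset _ (@rshift_inj N q)); apply: eq_card => i; rewrite !inE.
  case: (split_ordP i) => j ->.
    rewrite [X in _ = X](_ : _ = false); last first.
      apply/negP => /andP[+ /bl jb0]; rewrite imset_f //.
    by apply/negP => /imsetP[a _ /eqP]; rewrite eq_lrshift.
  rewrite mem_imset; last exact: rshift_inj.
  rewrite inE; case: (_ \in b); rewrite ?andbF ?andbT //; apply/esym/negP.
  by move=> /imsetP[c _ /eqP]; rewrite eq_rlshift.
exists [ffun i : 'I_q => nth i0 (enum b0) i].
exists [ffun i : 'I_q => nth i (enum sg) (i - rho)].
rewrite -row_full_unit /row_full eqn_leq rank_leq_col /= -{1}rQ -rb; apply: mxrankS.
apply/rsp_subP => i; case: (split_ordP i) => j -> jb.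
  have jb0 := bl j jb; have lt : (index j (enum b0) < rho)%N.
    by rewrite -cb0 cardE index_mem mem_enum.
  have ltq : (index j (enum b0) < q)%N by rewrite -cb cb0 ltn_addr.
  suff -> : row (lshift q j) Q = row (Ordinal ltq) (completion
      [ffun i : 'I_q => nth i0 (enum b0) i] [ffun i : 'I_q => nth i (enum sg) (i - rho)]).
    exact: row_sub.
  rewrite rowl; apply/rowP => a; rewrite !mxE /= lt ffunE /= nth_index //.
  by rewrite mem_enum.
have jsg : j \in sg by rewrite inE.
have lt : (index j (enum sg) < #|sg|)%N by rewrite cardE index_mem mem_enum.
have ltq : (rho + index j (enum sg) < q)%N.
  by apply: leq_trans (eq_leq cb); rewrite cb0 ltn_add2l.
suff -> : row (rshift N j) Q = row (Ordinal ltq) (completion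
    [ffun i : 'I_q => nth i0 (enum b0) i] [ffun i : 'I_q => nth i (enum sg) (i - rho)]).
  exact: row_sub.
rewrite rowr; apply/rowP => a; rewrite !mxE /= ltnNge leq_addr /= ffunE /= addKn.
by rewrite nth_index ?mem_enum // eq_sym.
Qed.

(** The first [rho] rows are independent, hence span the column space of [L]; the remaining
    coordinates, which are entries of [v], stay free. *)
Lemma completion_kernel f ka (v : 'rV[K]_q) : \rank L = rho ->
  completion f ka \in unitmx ->
  (v *m L == 0) = [forall i : 'I_q, (i < rho)%N ==> ((v *m (completion f ka)^T) 0 i == 0)].
Proof.
move=> rL uC.
have E (i : 'I_q) : (i < rho)%N -> (v *m (completion f ka)^T) 0 i = (v *m L) 0 (f i).
  by move=> lt; rewrite !mxE; apply: eq_bigr => a _; rewrite !mxE lt.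
apply/eqP/forallP => [v0 i|all0].
  by apply/implyP => lt; rewrite E // v0 mxE.
pose S := [set i : 'I_q | (i < rho)%N].
have cS : #|S| = rho.
  have le : (rho <= q)%N by rewrite -rL rank_leq_row.
  rewrite -sum1_card (eq_bigl (fun i : 'I_q => (i < rho)%N)); last by move=> i; rewrite inE.
  by rewrite -(big_ord_widen q (fun=> 1%N)) // sum1_card card_ord.
have iT : indep (completion f ka) setT.
  by rewrite /indep cardsT card_ord /rk rsp_setT mxrank_unit.
have iS := indepS (subsetT S) iT.
have SL : (rsp (completion f ka) S <= L^T)%MS.
  apply/rsp_subP => i; rewrite inE => lt.
  suff -> : row i (completion f ka) = row (f i) L^T by apply: row_sub.
  by apply/rowP => a; rewrite !mxE lt.
have LS : (L^T <= rsp (completion f ka) S)%MS.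
  have [_ <-] := mxrank_leqif_sup SL.
  by rewrite mxrank_tr rL -/(rk _ _) (eqP iS) cS.
apply: (can_inj (@trmxK _ _ _)); rewrite trmx_mul trmx0; apply/sub_kermxP.
apply: submx_trans LS _; apply/rsp_subP => i; rewrite inE => lt.
apply/sub_kermxP/matrixP => x y; rewrite (ord1 x) (ord1 y) [RHS]mxE.
have /implyP/(_ lt)/eqP e := all0 i; rewrite -[RHS]e !mxE.
by apply: eq_bigr => a _; rewrite !mxE mulrC.
Qed.

End Completion.

Section RegularMatrices.
Variables (K : fieldType) (Th : finType) (h : (Th -> K) -> K).
Hypothesis ph : polyfun h.

Definition regmx a b (M : (Th -> K) -> 'M[K]_(a, b)) := forall i j, reg h (fun t => M t i j).

Lemma regmx_invmx a (M : (Th -> K) -> 'M[K]_a) : regmx M ->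
  (forall t, h t != 0 -> M t \in unitmx) -> reg h (fun t => (\det (M t))^-1) ->
  regmx (fun t => invmx (M t)).
Proof.
move=> rM uM rdet i j.
apply: (reg_ext (u := fun t => (\det (M t))^-1 * cofactor (M t) j i)).
  by move=> t ht; rewrite /invmx uM // !mxE.
apply: reg_mul => //; rewrite /cofactor; apply: reg_mul => //; first exact: reg_const.
apply: reg_det => // i' j'; apply: reg_ext (rM (lift j i') (lift i j')) => t _.
by rewrite !mxE.
Qed.

Lemma reg_localize_all (B : finType) (g : B -> (Th -> K) -> K) :
  (forall b, reg h (g b)) -> exists h',
  [/\ polyfun h', forall t, (h' t != 0) = (h t != 0) && [forall b, g b t != 0]
    & forall u, reg h u -> reg h' u].
Proof.
move=> rg; have [|h' [ph' E r' _]] := @reg_localize K Th h ph (fun t => \prod_b g b t).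
  exact: reg_prod.
exists h'; split=> // t; rewrite E; congr (_ && _).
apply/prodf_neq0/forallP => H b; first exact: H.
by move=> _; apply: H.
Qed.

End RegularMatrices.

(** * Charted families and extension by one column *)

Section Charted.
Variables (K : fieldType) (q n : nat).
Implicit Types (Om : 'M[K]_(q, n) -> Prop).

(* [Om] is a finite union of pieces, each parametrized by a (possibly empty)
   principal open subset of [K^Th], [#|Th| = d]; the parameters are themselves
   entries of the first [m] columns. *)
Definition charted (m d : nat) Om :=
  exists (Th J : finType) (h : J -> (Th -> K) -> K)
    (phi : J -> (Th -> K) -> 'M[K]_(q, n)) (pos : J -> Th -> 'I_q * 'I_n),
  [/\ #|Th| = d, forall j, polyfun (h j) /\ regmx (h j) (phi j),
      forall j th, ((pos j th).2 < m)%N,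
      forall j t, h j t != 0 -> Om (phi j t) /\
         forall th, phi j t (pos j th).1 (pos j th).2 = t th
    & forall X, Om X -> exists j t, h j t != 0 /\ X = phi j t].

Definition set_col (m : 'I_n) (X : 'M[K]_(q, n)) (v : 'rV[K]_q) : 'M[K]_(q, n) :=
  \matrix_(a, j) if j == m then v 0 a else X a j.

Definition regular_map a b (F : 'M[K]_(q, n) -> 'M[K]_(a, b)) :=
  forall (Th : finType) (h : (Th -> K) -> K) (phi : (Th -> K) -> 'M[K]_(q, n)),
    polyfun h -> regmx h phi -> regmx h (fun t => F (phi t)).

Lemma regmx_set_col (Th : finType) (h : (Th -> K) -> K) (m : 'I_n) phi v :
  regmx h phi -> regmx h v -> regmx h (fun t => set_col m (phi t) (v t)).
Proof.
move=> rp rv i j; case: (altP (j =P m)) => [->|jm].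
  by apply: reg_ext (rv 0 i) => t _; rewrite mxE eqxx.
by apply: reg_ext (rp i j) => t _; rewrite mxE (negbTE jm).
Qed.

Lemma charted_empty_prefix : charted 0 0 (fun X => X = 0).
Proof.
exists void, unit, (fun _ _ => 1), (fun _ _ => 0), (fun _ => of_void _).
split=> //.
- by rewrite card_void.
- move=> _; split; first exact: polyfun_const.
  by move=> i j; apply: reg_ext (reg_const _ 0) => t _; rewrite mxE.
- by move=> X X0; exists tt, (of_void _); split; rewrite ?oner_neq0.
Qed.

Lemma charted_const (m : 'I_n) d Om Om' v0 :
  (forall Y, Om' Y <-> exists2 X, Om X & Y = set_col m X v0) ->
  charted m d Om -> charted m.+1 d Om'.
Proof.
move=> Om'E [Th [J [h [phi [pos [cTh rphi posm snd cpl]]]]]].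
exists Th, J, h, (fun j t => set_col m (phi j t) v0), pos; split=> //.
- move=> j; have [pj rj] := rphi j; split=> //; apply: regmx_set_col => // a b.
  exact: reg_const.
- by move=> j th; apply: leqW (posm j th).
- move=> j t ht; have [OmX posE] := snd j t ht; split.
    by apply/Om'E; exists (phi j t).
  move=> th; rewrite mxE ifN ?posE //; apply: contraTneq (posm j th) => ->.
  by rewrite ltnn.
- by move=> Y /Om'E[X /cpl[j [t [ht ->]]] ->]; exists j, t.
Qed.

Variables (m : 'I_n) (d rho N : nat) (i0 : 'I_N).
Variables (Om Om' : 'M[K]_(q, n) -> Prop).
Variables (L : 'M[K]_(q, n) -> 'M[K]_(q, N)).
Variables (BT CT : finType) (G : BT -> CT -> 'M[K]_(q, n) -> 'cV[K]_q).
Hypotheses (le_rho : (rho <= q)%N) (rL : regular_map L).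
Hypothesis rG : forall B c, regular_map (G B c).
Hypothesis rankL : forall X, Om X -> \rank (L X) = rho.
Hypothesis Om'E : forall Y, Om' Y <-> exists X v,
  [/\ Om X, v *m L X = 0, forall B, exists c, (v *m G B c X) 0 0 != 0 & Y = set_col m X v].

Let Fr := {i : 'I_q | (rho <= i)%N}.

Lemma card_free : #|{: Fr}| = (q - rho)%N.
Proof.
have c1 : #|(fun i : 'I_q => (i < rho)%N)| = rho.
  rewrite -sum1_card (eq_bigl (fun i : 'I_q => (i < rho)%N)) //.
  by rewrite -(big_ord_widen q (fun=> 1%N)) // sum1_card card_ord.
apply/eqP; rewrite card_sig -(eqn_add2l rho) subnKC //; apply/eqP.
have := cardC (fun i : 'I_q => (i < rho)%N); rewrite c1 card_ord => e.
rewrite -[RHS]e; congr (_ + _)%N; apply: eq_card => i.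
by rewrite !inE -leqNgt.
Qed.

Let wrow (s : Fr -> K) : 'rV[K]_q := \row_i oapp s 0 (insub i).

(** The vector whose pairings with the rows of the completion are 0 for the first [rho] rows and [s]
    for the others. *)
Let newcol f ka (X : 'M[K]_(q, n)) (s : Fr -> K) : 'rV[K]_q :=
  wrow s *m invmx (completion (L X) rho f ka)^T.

Lemma fiber_chart (Th : finType) (h : (Th -> K) -> K) phi f ka (chi : BT -> CT) :
  polyfun h -> regmx h phi -> exists h' : (Th + Fr -> K) -> K,
  [/\ polyfun h',
      forall t, (h' t != 0) = [&& h (t \o inl) != 0,
         completion (L (phi (t \o inl))) rho f ka \in unitmx
         & [forall B, (newcol f ka (phi (t \o inl)) (t \o inr)
                       *m G B (chi B) (phi (t \o inl))) 0 0 != 0]]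
    & regmx h' (fun t => set_col m (phi (t \o inl)) (newcol f ka (phi (t \o inl)) (t \o inr)))].
Proof.
move=> ph rphi; pose C t := completion (L (phi t)) rho f ka.
have rC : regmx h C.
  move=> i a; have [lt|ge] := boolP (i < rho)%N.
    by apply: reg_ext (rL ph rphi a (f i)) => t _; rewrite mxE lt.
  by apply: reg_ext (reg_const _ (a == ka i)%:R) => t _; rewrite mxE (negbTE ge).
have [h1 [ph1 h1E r1 r1i]] := reg_localize ph (reg_det ph rC).
pose h2 (t : Th + Fr -> K) := h1 (fun th => t (inl th)).
have pinl th : polyfun (fun t : Th + Fr -> K => t (inl th)) by apply: polyfun_coord.
have ph2 : polyfun h2 by apply: (polyfun_comp ph1 pinl).
have pull u : reg h1 u -> reg h2 (fun t => u (t \o inl)) by move=> ru; apply: (reg_pull pinl ru).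
have rphi2 : regmx h2 (fun t => phi (t \o inl)).
  by move=> i j; apply: (pull (fun t => phi t i j)); apply: r1.
have rv : regmx h2 (fun t => newcol f ka (phi (t \o inl)) (t \o inr)).
  apply: reg_mulmx => //.
    move=> i j; case: (insubP {: Fr} j) => [j' _ ej|nj].
      apply: reg_ext (reg_poly h2 (@polyfun_coord K (Th + Fr)%type (inr j'))) => t _.
      by rewrite mxE -ej valK.
    by apply: reg_ext (reg_const _ 0) => t _; rewrite mxE insubN.
  apply: regmx_invmx => //.
  - move=> i j; apply: (pull (fun t => (C t)^T i j)); apply: r1.
    by apply: reg_ext (rC j i) => t _; rewrite [RHS]mxE.
  - by move=> t; rewrite /h2 h1E => /andP[_]; rewrite unitmx_tr unitmxE unitfE.
  - apply: reg_ext (pull _ r1i) => t _; by rewrite det_tr.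
have [|h3 [ph3 h3E r3]] := @reg_localize_all K _ h2 ph2 BT (fun B t =>
    (newcol f ka (phi (t \o inl)) (t \o inr) *m G B (chi B) (phi (t \o inl))) 0 0).
  by move=> B; apply: reg_mulmx => //; apply: rG.
exists h3; split=> //.
  by move=> t; rewrite h3E /h2 h1E -andbA unitmxE unitfE.
by apply: regmx_set_col => i j; apply: r3.
Qed.

(** The new column ranges over an open part of the kernel of [L X], of constant dimension. A chart
    is indexed by a chart for [X], a completion, and a choice [chi] of a nonvanishing form for each
    [B]. *)
Lemma charted_fiber : charted m d Om -> charted m.+1 (d + (q - rho)) Om'.
Proof.
move=> [Th [J [h [phi [pos [cTh rphi posm snd cpl]]]]]].
pose J' : finType := (J * {ffun 'I_q -> 'I_N} * {ffun 'I_q -> 'I_q} * {ffun BT -> CT})%type.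
pose emb (t : Th + Fr -> K) (j : J) f ka :=
  set_col m (phi j (t \o inl)) (newcol f ka (phi j (t \o inl)) (t \o inr)).
pose good (x : J') (h' : (Th + Fr -> K) -> K) := [/\ polyfun h',
  forall t, (h' t != 0) = [&& h x.1.1.1 (t \o inl) != 0,
     completion (L (phi x.1.1.1 (t \o inl))) rho x.1.1.2 x.1.2 \in unitmx
     & [forall B, (newcol x.1.1.2 x.1.2 (phi x.1.1.1 (t \o inl)) (t \o inr)
                   *m G B (x.2 B) (phi x.1.1.1 (t \o inl))) 0 0 != 0]]
  & regmx h' (fun t => emb t x.1.1.1 x.1.1.2 x.1.2)].
have [h' h'P] : {h' & forall x, good x (h' x)}.
  by apply: choice => x; have [ph rphi'] := rphi x.1.1.1; apply: fiber_chart.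
have newcolE f ka X s (i : 'I_q) : completion (L X) rho f ka \in unitmx ->
    (newcol f ka X s *m (completion (L X) rho f ka)^T) 0 i = oapp s 0 (insub i).
  by move=> uC; rewrite mulmxKV ?unitmx_tr // mxE.
have CE f ka X (i a : 'I_q) : (rho <= i)%N ->
    (completion (L X) rho f ka)^T a i = (a == ka i)%:R.
  by move=> ge; rewrite !mxE ltnNge ge.
exists ((Th + {i : 'I_q | (rho <= i)%N})%type : finType), J', h', (fun (x : J') t => emb t x.1.1.1 x.1.1.2 x.1.2),
  (fun (x : J') (th : Th + Fr) => match th with inl th => pos x.1.1.1 th | inr i => (x.1.2 (val i), m) end).
split.
- by rewrite card_sum cTh card_free.
- by move=> x; case: (h'P x).
- move=> x [th|i] //=; exact: leqW (posm _ _).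
- move=> [[[j f] ka] chi] t; have [_ -> _] := h'P (j, f, ka, chi) => /=.
  move=> /and3P[ht uC /forallP Gt]; have [OmX posE] := snd j _ ht; split.
    apply/Om'E; exists (phi j (t \o inl)), (newcol f ka (phi j (t \o inl)) (t \o inr)).
    split=> //; last by move=> B; exists (chi B).
    apply/eqP; rewrite (completion_kernel _ (rankL OmX) uC); apply/forallP => i.
    by apply/implyP => lt; rewrite newcolE // insubN // -ltnNge.
  move=> [th|i]; rewrite /emb mxE /=.
    rewrite ifN ?posE //; apply: contraTneq (posm j th) => ->; by rewrite ltnn.
  have := newcolE f ka (phi j (t \o inl)) (t \o inr) (val i) uC.
  rewrite valK /= eqxx => <-; rewrite [RHS]mxE (bigD1 (ka (val i))) //=.
  rewrite CE ?(valP i) // eqxx mulr1 big1 ?addr0 // => a ne.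
  by rewrite CE ?(valP i) // (negbTE ne) mulr0.
- move=> Y /Om'E[X [v [OmX vL Gv ->]]].
  have [j [t [ht Xt]]] := cpl X OmX.
  have [f [ka uC]] := completion_exists i0 (rankL OmX).
  have [chi chiP] := fin_all_exists Gv.
  pose s (i : Fr) := v 0 (ka (val i)).
  have vE : newcol f ka X s = v.
    rewrite -[RHS](mulmxK (_ : (completion (L X) rho f ka)^T \in unitmx)) ?unitmx_tr //.
    congr (_ *m _); apply/rowP => i; rewrite mxE.
    case: (insubP {: Fr} i) => [i' ge ei|lt].
      rewrite /= /s ei [RHS]mxE (bigD1 (ka i)) //= CE // eqxx mulr1.
      by rewrite big1 ?addr0 // => a ne; rewrite CE // (negbTE ne) mulr0.
    move/eqP: vL; rewrite (completion_kernel _ (rankL OmX) uC) => /forallP/(_ i).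
    by rewrite ltnNge lt => /eqP ->.
  exists (j, f, ka, [ffun B => chi B]).
  exists (fun x => match x with inl th => t th | inr i => s i end).
  have -> : (h' (j, f, ka, [ffun B => chi B]) (fun x => match x with inl th => t th | inr i => s i end) != 0) = true.
    have [_ -> _] := h'P (j, f, ka, [ffun B => chi B]); apply/and3P => /=.
    rewrite -[_ \o inl]/t -[_ \o inr]/s -Xt ht uC vE; split=> //.
    by apply/forallP => B; rewrite ffunE.
  by split=> //; rewrite /emb -[_ \o inl]/t -[_ \o inr]/s -Xt vE.
Qed.

End Charted.

(** * Row echelon forms of the stratum *)

(** Adjoin [v] as a further column, extend [v] and [I] to a basis, and let [H] be that basis without
    [v]. *)
Lemma kap_witness (K : fieldType) (k p : nat) (Z : 'M[K]_(k.+1, p)) (I : {set 'I_p})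
    (v : 'rV[K]_k.+1) :
  rk Z^T setT = k.+1 -> indep Z^T I -> ~~ (v <= rsp Z^T I)%MS ->
  exists H : {set 'I_p}, [/\ I \subset H, #|H| = k & (v *m kap Z H) 0 0 != 0].
Proof.
move=> rZ iI vI; pose Q := col_mx v Z^T.
have row0 : row (lshift p 0) Q = v by rewrite rowKu; apply/rowP => a; rewrite !mxE.
have row1 j : row (rshift 1 j) Q = row j Z^T by rewrite rowKd.
have rQ (S : {set 'I_p}) : (rsp Q (@rshift 1 p @: S) :=: rsp Z^T S)%MS by apply: rsp_imset.
have n0 (S : {set 'I_p}) : lshift p 0 \notin @rshift 1 p @: S.
  by apply/negP => /imsetP[j _ /eqP]; rewrite eq_lrshift.
have iQ (S : {set 'I_p}) : indep Q (@rshift 1 p @: S) = indep Z^T S.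
  by rewrite /indep /rk rQ card_imset //; apply: rshift_inj.
have iI' : indep Q (lshift p 0 |: @rshift 1 p @: I).
  by rewrite indepU1 ?n0 ?iQ // row0 rQ.
have [b [Ib _ ib rb]] := indep_extend (subsetT _) iI'.
pose H := [set j | rshift 1 j \in b].
have bE : b = lshift p 0 |: @rshift 1 p @: H.
  apply/setP => i; rewrite in_setU1; case: (split_ordP i) => j ->.
    rewrite (ord1 j) eqxx; apply: (subsetP Ib); by rewrite !inE eqxx.
  by rewrite eq_rlshift mem_imset ?inE //; apply: rshift_inj.
have cb : #|b| = k.+1.
  rewrite -(eqP ib) rb /rk rsp_setT; apply/eqP; rewrite eqn_leq rank_leq_col -{1}rZ /rk rsp_setT.
  by rewrite /= -addsmxE mxrankS // addsmxSr.
have cH : #|H| = k.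
  move: cb; rewrite bE cardsU1 n0 card_imset; [by case | exact: rshift_inj].
have iH : indep Z^T H by rewrite -iQ; apply: indepS ib; rewrite bE subsetUr.
exists H; split=> //.
  apply/subsetP => j jI; rewrite inE; apply: (subsetP Ib).
  by rewrite in_setU1 imset_f ?orbT.
apply: kap_notin => //; move: ib; rewrite {1}bE indepU1 ?n0 ?iQ //.
by rewrite row0 rQ.
Qed.

Lemma rsp_zero_coord (K : fieldType) (q n : nat) (X : 'M[K]_(q, n)) (T : {set 'I_n})
    (u : 'rV[K]_q) (a : 'I_q) :
  (forall j, j \in T -> X a j = 0) -> (u <= rsp X^T T)%MS -> u 0 a = 0.
Proof.
move=> X0 uT; have coord (w : 'rV[K]_q) : (w *m (delta_mx a 0 : 'cV_q)) 0 0 = w 0 a.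
  rewrite mxE (bigD1 a) //= big1 ?addr0; first by rewrite mxE !eqxx mulr1.
  by move=> b ba; rewrite mxE (negbTE ba) mulr0.
have : (rsp X^T T <= kermx (delta_mx a 0 : 'cV[K]_q))%MS.
  apply/rsp_subP => j jT; apply/sub_kermxP/matrixP => x y.
  by rewrite (ord1 x) (ord1 y) coord !mxE X0.
by move=> /(submx_trans uT)/sub_kermxP/matrixP/(_ 0 0); rewrite coord mxE.
Qed.

Lemma regular_map_kap (K : fieldType) (k n p : nat) (Z : 'M[K]_(k.+1, n) -> 'M[K]_(k.+1, p))
    (H : {set 'I_p}) : regular_map Z -> regular_map (fun X => kap (Z X) H).
Proof.
move=> rZ Th h phi ph rphi i j.
apply: (reg_ext (u := fun t => cofactor (col_mx (0 : 'rV_k.+1) (crows (Z (phi t)) H) : 'M_k.+1) 0 i)).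
  by move=> t _; rewrite mxE.
rewrite /cofactor; apply: reg_mul => //; first exact: reg_const.
apply: reg_det => // i' j'.
pose l := lift i j'; pose e := nth None [seq Some c | c <- enum H] i'.
apply: (reg_ext (u := fun t => oapp (fun c => Z (phi t) l c) 0 e)); last first.
  case: e => [c|]; last exact: reg_const.
  exact: (rZ _ _ _ ph rphi).
move=> t _; rewrite !mxE; case: splitP => [a /= e0|a /= e0].
  by have := ltn_ord a; rewrite -e0.
rewrite mxE; have -> : (a : nat) = i' by move: e0; rewrite /bump /= add1n => -[].
rewrite /e -/l; case: (ltnP i' (size (enum H))) => lt; last first.
  by rewrite !nth_default ?size_map.
have [c0] : exists c : 'I_p, true by move: lt; case: (enum H) => // c; exists c.
by move=> _; rewrite !(nth_map c0).
Qed.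

Lemma regular_map_aug (K : fieldType) (k n : nat) :
  regular_map (fun X : 'M[K]_(k.+1, n) => row_mx X (1%:M : 'M_k.+1)).
Proof.
move=> Th h phi ph rphi i j; case: (split_ordP j) => l ->.
  by apply: reg_ext (rphi i l) => t _; rewrite row_mxEl.
by apply: reg_ext (reg_const h ((1%:M : 'M[K]_k.+1) i l)) => t _; rewrite row_mxEr.
Qed.

(** * Adding a column to a prefix of the echelon form *)

Section Positroid.
Variables (F : realFieldType) (k n : nat) (A : 'M[F]_(k.+1, n)) (P : {set {set 'I_n}}).
Hypothesis A_ge0 : forall S : {set 'I_n}, #|S| = k.+1 -> 0 <= minor A S.
Hypothesis rA : \rank A = k.+1.
Hypothesis PA : forall S, (S \in P) = (minor A S != 0).

Notation r := (mrk P).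
Notation q := k.+1.

Lemma mrk_rk S : r S = rk A^T S. Proof. exact: mrkE. Qed.

Lemma mrk_mono (S T : {set 'I_n}) : S \subset T -> (r S <= r T)%N.
Proof. by rewrite !mrk_rk; apply: rkS. Qed.

Lemma mrk_submod (S T : {set 'I_n}) : (r (S :|: T) + r (S :&: T) <= r S + r T)%N.
Proof. by rewrite !mrk_rk; apply: rk_submod. Qed.

Lemma spansE m T : spans r m T = (row m A^T <= rsp A^T T)%MS.
Proof. by rewrite /spans !mrk_rk mem_rsp_rk. Qed.

Lemma positroid_separated m : separated r m.
Proof.
move=> y0 y1 T Tm y0T y1T; rewrite !spansE => sT nsT.
have [d dP dE] := separation A_ge0 rA Tm y0T y1T sT nsT.
by exists d => //=; rewrite !mrk_rk; exact: dE.
Qed.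

Lemma mrkU1 m T : r (m |: T) = (r T + ~~ spans r m T)%N.
Proof. by rewrite spansE !mrk_rk rkU1. Qed.

Lemma mrk_leq S : (r S <= q)%N.
Proof. by rewrite mrk_rk rk_le. Qed.

Lemma mrk_basis (T : {set 'I_n}) : exists B : {set 'I_n}, [/\ B \subset T, r B = #|B| & r B = r T].
Proof.
have [B [BT /eqP iB rB]] := basis_exists A^T T; exists B.
by rewrite !mrk_rk; split.
Qed.

Variable K : fieldType.
Implicit Types (X Y : 'M[K]_(q, n)) (v : 'rV[K]_q) (T : {set 'I_n}).

(* The prefixes of the row echelon forms of the points of the stratum. *)
Definition omega (m : nat) X :=
  [/\ forall (j : 'I_n) (a : 'I_q), (m <= j)%N -> X a j = 0,
      forall T, T \subset pre n m -> rk X^T T = r T,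
      forall (j : 'I_n) (a : 'I_q), (j < m)%N -> ~~ spans r j (pre n j) ->
        X a j = (a == r (pre n j) :> nat)%:R
    & forall (j : 'I_n) (a : 'I_q), (j < m)%N -> (r (pre n j.+1) <= a)%N -> X a j = 0].

Let pivot (m : nat) : 'rV[K]_q := \row_a (a == r (pre n m) :> nat)%:R.

Lemma rsp_set_col (m : 'I_n) X v T : T \subset pre n m ->
  (rsp (set_col m X v)^T T :=: rsp X^T T)%MS.
Proof.
move=> Tm; have E j : j \in T -> row j (set_col m X v)^T = row j X^T.
  move=> jT; apply/rowP => a; rewrite !mxE ifN //; apply: contraTneq (subsetP Tm j jT) => ->.
  by rewrite inE ltnn.
by apply/eqmxP/andP; split; apply/rsp_subP => j jT; rewrite -?E ?row_rsp // E ?row_rsp.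
Qed.

Lemma row_set_col (m : 'I_n) X v : row m (set_col m X v)^T = v.
Proof. by apply/rowP => a; rewrite !mxE eqxx. Qed.

Lemma preS_sub (m m' : nat) : (m <= m')%N -> pre n m \subset pre n m'.
Proof. by move=> le; apply/subsetP => j; rewrite !inE => /leq_trans; apply. Qed.

(** Prescribing the ranks of the sets containing [m] amounts to prescribing which spans contain the
    new column. *)
Lemma omega_step (m : 'I_n) Y : omega m.+1 Y <-> exists X v,
  [/\ omega m X, forall T, T \subset pre n m -> (v <= rsp X^T T)%MS = spans r m T,
      ~~ spans r m (pre n m) -> v = pivot m,
      forall a : 'I_q, (r (pre n m.+1) <= a)%N -> v 0 a = 0 & Y = set_col m X v].
Proof.
split=> [[Y0 Yr Yp Yz]|[X [v [[X0 Xr Xp Xz] vT vp vz ->]]]].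
  pose X := set_col m Y 0; pose v := row m Y^T.
  have YE : Y = set_col m X v.
    by apply/matrixP => a j; rewrite !mxE; case: eqP => [->|_].
  have Xlt a (j : 'I_n) : (j < m)%N -> X a j = Y a j.
    by move=> jm; rewrite mxE ifN //; apply: contraTneq jm => ->; rewrite ltnn.
  have XY T : T \subset pre n m -> rk X^T T = rk Y^T T.
    by move=> Tm; rewrite /rk rsp_set_col.
  have Xr T : T \subset pre n m -> rk X^T T = r T.
    by move=> Tm; rewrite XY // Yr // (subset_trans Tm) // preS_sub.
  exists X, v; split=> //.
  - split=> // [j a|j a jm|j a jm].
    + rewrite leq_eqVlt => /orP[/eqP/val_inj <-|lt]; first by rewrite !mxE eqxx.
      rewrite mxE ifN ?Y0 //; by apply: contraTneq lt => ->; rewrite ltnn.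
    + by rewrite Xlt //; apply/Yp/ltnW.
    + by rewrite Xlt //; apply/Yz/ltnW.
  - move=> T Tm; have mT : m |: T \subset pre n m.+1 by rewrite preS setUS.
    rewrite -[RHS](_ : (row m Y^T <= rsp Y^T T)%MS = _).
      by rewrite {2}YE rsp_set_col.
    by rewrite mem_rsp_rk !Yr // (subset_trans Tm) // preS_sub.
  - by move=> ns; apply/rowP => a; rewrite !mxE Yp.
  - by move=> a le; rewrite !mxE Yz.
split.
- move=> j a lt; rewrite mxE ifN; first by rewrite X0 // ltnW.
  by apply: contraTneq lt => ->; rewrite ltnn.
- move=> T; case: (boolP (m \in T)) => mT; last first.
    move=> Tm; have {}Tm : T \subset pre n m.
      apply/subsetP => j jT; have := subsetP Tm j jT; rewrite preS in_setU1 => /orP[/eqP e|//].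
      by rewrite -e jT in mT.
    by rewrite /rk rsp_set_col // -/(rk _ _) Xr.
  rewrite -(setD1K mT) => Tm; have {}Tm : T :\ m \subset pre n m.
    apply/subsetP => j; rewrite !inE => /andP[jm jT]; have := subsetP Tm j.
    by rewrite setD1K // preS in_setU1 (negbTE jm) inE => /(_ jT).
  have -> : rk (set_col m X v)^T (m |: (T :\ m)) = (rk X^T (T :\ m) + ~~ (v <= rsp X^T (T :\ m))%MS)%N.
    by rewrite rkU1 row_set_col /rk !(rsp_set_col X v Tm).
  by rewrite vT // Xr // mrkU1.
- move=> j a; rewrite ltnS leq_eqVlt => /orP[/eqP/val_inj -> ns|lt ns].
    by rewrite mxE eqxx vp // mxE.
  by rewrite mxE ifN ?Xp //; apply: contraTneq lt => ->; rewrite ltnn.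
- move=> j a; rewrite ltnS leq_eqVlt => /orP[/eqP/val_inj -> le|lt le].
    by rewrite mxE eqxx vz.
  by rewrite mxE ifN ?Xz //; apply: contraTneq lt => ->; rewrite ltnn.
Qed.

Lemma omega_zero_row m X (u : 'rV[K]_q) (a : 'I_q) : omega m X ->
  (u <= rsp X^T (pre n m))%MS -> (r (pre n m) <= a)%N -> u 0 a = 0.
Proof.
move=> [_ _ _ Xz] uX le; apply: rsp_zero_coord uX => j; rewrite inE => jm.
by rewrite Xz // (leq_trans _ le) // mrk_mono // preS_sub.
Qed.

(** The pivot is a unit vector in a row where all earlier columns are zero, so it avoids every
    span. *)
Lemma omega_step_coloop (m : 'I_n) Y : ~~ spans r m (pre n m) ->
  omega m.+1 Y <-> exists2 X, omega m X & Y = set_col m X (pivot m).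
Proof.
move=> ns; rewrite omega_step; split=> [[X [v [OX _ vp _ ->]]]|[X OX ->]].
  by exists X; rewrite ?vp.
have rS : r (pre n m.+1) = (r (pre n m)).+1 by rewrite preS mrkU1 ns addn1.
exists X, (pivot m); split=> //.
- move=> T Tm; transitivity false.
    apply/negP => /submx_trans/(_ (rspS _ Tm)) sub.
    have lt : (r (pre n m) < q)%N by rewrite -rS mrk_leq.
    have /eqP := omega_zero_row (a := Ordinal lt) OX sub (leqnn _).
    by rewrite mxE eqxx oner_eq0.
  by apply/esym/negbTE; apply: contra ns; apply: (spansS mrk_mono mrk_submod Tm).
- by move=> a; rewrite rS mxE => lt; rewrite gtn_eqF.
Qed.

(* Appending the identity lets the forms [kap (aug X) H] cut out the span of any
   set of columns of [X], even when [X] has rank less than [q]. *)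
Let aug X : 'M[K]_(q, n + q) := row_mx X 1%:M.

Let inpre (m : nat) (H : {set 'I_(n + q)}) : {set 'I_n} := [set j in pre n m | lshift q j \in H].

Let ev (i : 'I_#|{: {set 'I_(n + q)}}|) : {set 'I_(n + q)} := enum_val i.

(** Equations of [arc_cap]. All subsets serve as column indices, and those giving no equation get a
    zero column, so the shape does not depend on [X]. *)
Definition fiber_eqs (m : 'I_n) X : 'M[K]_(q, #|{: {set 'I_(n + q)}}|) :=
  \matrix_(a, i) if (#|ev i| == k) && spans r m (inpre m (ev i))
                 then kap (aug X) (ev i) a 0 else 0.

Lemma row_aug X j : row (lshift q j) (aug X)^T = row j X^T.
Proof. by apply/rowP => a; rewrite !mxE (unsplitK (inl j)). Qed.

Lemma rk_aug X : rk (aug X)^T setT = q.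
Proof.
apply/eqP; rewrite eqn_leq rk_le /= -{1}(mxrank1 K q) /rk; apply: mxrankS.
apply/row_subP => a; have -> : row a 1%:M = row (rshift n a) (aug X)^T.
  by apply/rowP => b; rewrite !mxE (unsplitK (inr a)) mxE eq_sym.
by rewrite row_rsp ?inE.
Qed.

Lemma rsp_aug X T : (rsp (aug X)^T (@lshift n q @: T) :=: rsp X^T T)%MS.
Proof. by apply: rsp_imset => j; apply: row_aug. Qed.

Lemma kap_aug_witness X B v : indep X^T B -> ~~ (v <= rsp X^T B)%MS ->
  exists H : {set 'I_(n + q)}, [/\ @lshift n q @: B \subset H, #|H| = k
    & (v *m kap (aug X) H) 0 0 != 0].
Proof.
move=> iB vB; apply: kap_witness; first exact: rk_aug.
  by rewrite /indep /rk rsp_aug card_imset //; apply: lshift_inj.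
by rewrite rsp_aug.
Qed.

(** By [arc_cap_sub] every equation holds on [arc_cap]. Conversely, a vector outside the span of
    some [sarc b] is detected by a form through a basis of that arc. *)
Lemma fiber_eqsP (m : 'I_n) X v : omega m X -> spans r m (pre n m) ->
  (v *m fiber_eqs m X == 0) = (v <= arc_cap r m X^T m)%MS.
Proof.
move=> [_ Xr _ _] sm; apply/eqP/idP => [v0|vcap]; last first.
  apply/rowP => i; rewrite [RHS]mxE mxE.
  case E: ((#|ev i| == k) && spans r m (inpre m (ev i))).
    move/andP: E => [/eqP cH sH].
    transitivity ((v *m kap (aug X) (ev i)) 0 0).
      by rewrite !mxE; apply: eq_bigr => a _; rewrite !mxE cH eqxx sH.
    rewrite kap_rsp ?mxE //.
    have Hm : inpre m (ev i) \subset pre n m by apply/subsetP => j; rewrite inE => /andP[].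
    apply: submx_trans vcap _.
    have s1 := arc_cap_sub mrk_mono mrk_submod (@positroid_separated m) Xr Hm sH.
    apply: submx_trans s1 _.
    by apply/rsp_subP => j; rewrite inE => /andP[_ jH]; rewrite -row_aug row_rsp.
  by apply: big1 => a _; rewrite !mxE E mulr0.
apply/sub_bigcapmxP => b _; set T := sarc r m b.
have Tm : T \subset pre n m by apply: arc_sub.
have sT : spans r m T by apply: spans_sarc.
have [B [BT rB rBT]] := mrk_basis T.
have Bm := subset_trans BT Tm.
have iB : indep X^T B by rewrite /indep Xr // rB.
apply/negPn/negP => vT; have vB : ~~ (v <= rsp X^T B)%MS.
  by apply: contra vT => /submx_trans; apply; apply: rspS.
have [H [BH cH]] := kap_aug_witness iB vB.
have sH : spans r m (inpre m H).
  have sB : spans r m B.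
    have := spansE m B; rewrite spansE (rsp_eq BT) -?mrk_rk //.
    by move: sT; rewrite spansE => ->.
  apply: (spansS mrk_mono mrk_submod _ sB); apply/subsetP => j jB.
  rewrite inE (subsetP Bm) // (subsetP BH) // imset_f //.
have /rowP/(_ (enum_rank H)) := v0; rewrite [in X in _ = X -> _]mxE => e /negP[].
rewrite -[X in _ == X]e; apply/eqP; rewrite !mxE; apply: eq_bigr => a _.
by rewrite !mxE /ev enum_rankK cH eqxx sH.
Qed.

Lemma regular_fiber_eqs m : regular_map (fiber_eqs m).
Proof.
move=> Th h phi ph rphi a i.
case E: ((#|ev i| == k) && spans r m (inpre m (ev i))); last first.
  by apply: reg_ext (reg_const h 0) => t _; rewrite mxE E.
have := @regular_map_kap K k n (n + q) aug (ev i) (@regular_map_aug K k n).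
move=> /(_ Th h phi ph rphi a 0) rk; apply: reg_ext rk => t _.
by rewrite [RHS]mxE E.
Qed.

Let avoided (m : 'I_n) :=
  {B : {set 'I_n} | [&& B \subset pre n m, r B == #|B| & ~~ spans r m B]}.

(** Nonvanishing at [v] for some [c] certifies that [v] lies outside the span of the columns in
    [B]. *)
Let avoid (m : 'I_n) (B : avoided m) (c : {set 'I_(n + q)}) X : 'cV[K]_q :=
  if (@lshift n q @: val B \subset c) && (#|c| == k) then kap (aug X) c else 0.

(** It suffices to lie in [arc_cap] and to avoid the spans of independent nonspanning sets; the zero
    rows follow from lying in the span of the prefix. *)
Lemma omega_step_fiber (m : 'I_n) Y : spans r m (pre n m) ->
  omega m.+1 Y <-> exists X v, [/\ omega m X, v *m fiber_eqs m X = 0,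
    forall B : avoided m, exists c, (v *m avoid B c X) 0 0 != 0 & Y = set_col m X v].
Proof.
move=> sm; rewrite omega_step; split=> [[X [v [OX vT vp vz ->]]]|[X [v [OX vL vG ->]]]].
  have [_ Xr _ _] := OX; exists X, v; split=> //.
    apply/eqP; rewrite fiber_eqsP //; apply/sub_bigcapmxP => b _.
    by rewrite vT ?arc_sub ?spans_sarc.
  move=> B; have /and3P[Bm /eqP iB nB] := valP B.
  have [||H [BH cH vH]] := @kap_aug_witness X (val B) v.
  - by rewrite /indep Xr // iB.
  - by rewrite vT.
  by exists H; rewrite /avoid BH cH eqxx.
have [_ Xr _ _] := OX.
move/eqP: vL; rewrite fiber_eqsP // => vcap.
have vT T : T \subset pre n m -> (v <= rsp X^T T)%MS = spans r m T.
  move=> Tm; case: (boolP (spans r m T)) => sT.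
    by apply: submx_trans vcap (arc_cap_sub mrk_mono mrk_submod (@positroid_separated m) Xr Tm sT).
  have [B [BT rB rBT]] := mrk_basis T.
  have Bm := subset_trans BT Tm.
  have sB : ~~ spans r m B by apply: contra sT; apply: (spansS mrk_mono mrk_submod BT).
  have BP : [&& B \subset pre n m, r B == #|B| & ~~ spans r m B] by rewrite Bm rB eqxx.
  have [c] := vG (Sub B BP); rewrite /avoid SubK.
  case: ifP => [/andP[Bc /eqP cc]|_]; last by rewrite mulmx0 mxE eqxx.
  apply: contraNF => vT; rewrite kap_rsp ?mxE // (submx_trans _ (rspS _ Bc)) //.
  by rewrite rsp_aug (rsp_eq BT) // !Xr.
exists X, v; split=> //; first by rewrite sm.
move=> a le; apply: (omega_zero_row OX); first by rewrite vT.
by apply: leq_trans le; apply/mrk_mono/preS_sub.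
Qed.

(** [rank_arc_cap] expresses the dimension through [r] alone, so it is the same for [X] and for
    [A]. *)
Lemma rank_fiber_eqs (m : 'I_n) X : omega m X -> spans r m (pre n m) ->
  \rank (fiber_eqs m X) = (q - \rank (arc_cap r m A^T m))%N.
Proof.
move=> OX sm; have [_ Xr _ _] := OX.
have e : \rank (kermx (fiber_eqs m X)) = \rank (arc_cap r m X^T m).
  apply: eqmx_rank; apply/andP; split; apply/row_subP => i.
    by rewrite -fiber_eqsP //; apply/eqP/sub_kermxP; apply: row_sub.
  by apply/sub_kermxP/eqP; rewrite fiber_eqsP // row_sub.
have e' : \rank (arc_cap r m X^T m) = \rank (arc_cap r m A^T m).
  have /eqP := rank_arc_cap mrk_mono mrk_submod (m := m) sm Xr m.
  rewrite -(rank_arc_cap mrk_mono mrk_submod sm (M := A^T)) => [/eqP [] //|T _].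
  by rewrite mrk_rk.
by rewrite -e' -e mxrank_ker subKn // rank_leq_row.
Qed.

Lemma charted_omega (m : nat) : (m <= n)%N ->
  exists2 d : nat, d%:Z = prefix_dim P m & charted m d (omega m).
Proof.
elim: m => [_|m IH lt].
  exists 0%N; first by rewrite prefix_dim0.
  have -> : omega 0 = (fun X => X = 0); last exact: charted_empty_prefix.
  apply/funext => X; apply/propext; split=> [[X0 _ _ _]|->].
    by apply/matrixP => a j; rewrite X0 // mxE.
  split=> // [j a _|T]; first by rewrite mxE.
  by rewrite pre0 subset0 => /eqP ->; rewrite rk0 mrk0.
have [d dE chd] := IH (ltnW lt); pose m' : 'I_n := Ordinal lt.
have sumE (S : {set 'I_n}) : S \subset pre n m' -> \sum_(T : {set 'I_n} | T \subset S) acoef P (m' |: T) =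
    (spans r m' S)%:R.
  move=> Sm; rewrite sum_acoefU1 // mrkU1; case: (spans r m' S) => /=.
    by rewrite addn0; ring.
  by rewrite addn1 -addn1 PoszD; ring.
case: (boolP (spans r m' (pre n m'))) => sm; last first.
  exists d; last exact: (charted_const (m := m') (fun Y => @omega_step_coloop m' Y sm) chd).
  (* Here no [S] in the prefix spans [m'], so the increment of [prefix_dim] is 0. *)
  rewrite dE -[m.+1]/(m'.+1) prefix_dimS (sum_by_upper_mobius _ (gam := fun=> 0)).
    by rewrite big1 ?addr0 // => S _; rewrite mulr0.
  move=> S Sm; rewrite sumE //; case: (boolP (spans r m' S)) => // sS.
  by rewrite (spansS mrk_mono mrk_submod Sm sS) in sm.
pose dl := \rank (arc_cap r m' A^T m').
have dlq : (dl <= q)%N by apply: rank_leq_row.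
(* The equations have rank [q - dl], leaving [dl] free parameters, which [staircase_sum] matches
   with the increment. *)
exists (d + (q - (q - dl)))%N.
  rewrite subKn // PoszD dE -[m.+1]/(m'.+1) prefix_dimS; congr (_ + _).
  rewrite (staircase_sum mrk_mono mrk_submod (@positroid_separated m') sm sumE).
  by rewrite /dl (rank_arc_cap mrk_mono mrk_submod sm (M := A^T)) // => T _; rewrite mrk_rk.
apply: (@charted_fiber K q n m' d (q - dl) _ (enum_rank (set0 : {set 'I_(n + q)})) (omega m') _ (fiber_eqs m')
   _ _ (@avoid m')) => //.
- exact: leq_subr.
- exact: regular_fiber_eqs.
- move=> B c Th h phi ph rphi; rewrite /avoid; case: (_ && _).
    exact: (@regular_map_kap K k n (n + q) aug c (@regular_map_aug K k n)).
  by move=> a b; apply: reg_ext (reg_const h 0) => t _; rewrite mxE.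
- by move=> X OX; apply: (@rank_fiber_eqs m').
- by move=> Y; apply: (@omega_step_fiber m').
Qed.

End Positroid.

(** * Cones in the Plücker embedding *)

Section Cone.
Variables (K : fieldType) (k n : nat).
Notation q := k.+1.
Implicit Types (X Y : 'M[K]_(q, n)) (Om : 'M[K]_(q, n) -> Prop).

Definition cone Om : pt K {set 'I_n} -> Prop :=
  fun x => exists l Y, [/\ l != 0, Om Y & x = fun S => l * minor Y S].

(** Scaling the first row realizes the scalar of the cone by a change of matrix. *)
Definition lead (l : K) : 'M[K]_q := diag_mx (\row_a if a == 0 then l else 1).

Lemma det_lead l : \det (lead l) = l.
Proof.
rewrite det_diag big_ord_recl mxE eqxx big1 ?mulr1 // => i _.
by rewrite mxE.
Qed.

Lemma unit_lead l : l != 0 -> lead l \in unitmx.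
Proof. by rewrite unitmxE det_lead unitfE. Qed.

Lemma rank_lead l Y : l != 0 -> \rank Y = q -> \rank (lead l *m Y) = q.
Proof.
move=> l0 rY; apply: etrans rY.
by rewrite (eqmxMfull Y) // row_full_unit unit_lead.
Qed.

Section Normalized.
Variable be : 'I_q -> 'I_n.
Hypothesis beI : injective be.
Let b0 : {set 'I_n} := be @: setT.

Lemma scale_recover : exists2 u : pt K {set 'I_n} -> K, polyfun u &
  forall l Y, colsub be Y = 1%:M -> u (fun S => l * minor Y S) = l.
Proof.
have [s sE] := minor_unsorted K beI.
exists (fun x => (-1) ^+ s * x b0).
  by apply: polyfun_mul; [apply: polyfun_const | apply: polyfun_coord].
by move=> l Y Y1; rewrite sE Y1 det1 mulr1 mulrCA -expr2 sqrr_sign mulr1.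
Qed.

Lemma det_replace_col Y a j : colsub be Y = 1%:M ->
  \det (colsub (fun i => if i == a then j else be i) Y) = Y a j.
Proof.
move=> /matrixP Y1; have Yb i l : Y i (be l) = (i == l)%:R by have := Y1 i l; rewrite !mxE.
rewrite (expand_det_row _ a) (bigD1 a) //= big1 ?addr0; last first.
  by move=> i ia; rewrite mxE (negbTE ia) Yb eq_sym (negbTE ia) mul0r.
rewrite mxE eqxx /cofactor -signr_odd addnn odd_double mul1r.
rewrite [X in \det X](_ : _ = 1%:M) ?det1 ?mulr1 //.
apply/matrixP => i l; rewrite !mxE eq_sym (negbTE (neq_lift _ _)) Yb.
by rewrite (inj_eq lift_inj).
Qed.

(** Replacing one column of the identity block by column [j] gives a minor equal to the entry, up to
    a sign; entries inside the block are constants. *)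
Lemma entry_recover a j : exists2 u : pt K {set 'I_n} -> K, polyfun u &
  forall l Y, colsub be Y = 1%:M -> u (fun S => l * minor Y S) = l * Y a j.
Proof.
case: (boolP (j \in b0)) => [/imsetP[i _ ->]|jb].
  have [u pu uE] := scale_recover; exists (fun x => u x * (a == i)%:R).
    by apply: polyfun_mul => //; apply: polyfun_const.
  move=> l Y Y1; rewrite uE //; congr (_ * _).
  by have /matrixP/(_ a i) := Y1; rewrite !mxE.
pose be' i := if i == a then j else be i.
have beI' : injective be'.
  move=> x y; rewrite /be'; case: (altP (x =P a)) => [->|xa]; case: (altP (y =P a)) => [->|ya] //.
  - by move=> e; rewrite e imset_f ?inE in jb.
  - by move=> e; rewrite -e imset_f ?inE in jb.
  - exact: beI.
have [s sE] := minor_unsorted K beI'.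
exists (fun x => (-1) ^+ s * x (be' @: setT)).
  by apply: polyfun_mul; [apply: polyfun_const | apply: polyfun_coord].
by move=> l Y Y1; rewrite sE det_replace_col // mulrCA signrMK.
Qed.

End Normalized.

Section ConeChart.
Variables (Th : finType) (h : (Th -> K) -> K) (phi : (Th -> K) -> 'M[K]_(q, n)).
Hypotheses (ph : polyfun h) (rphi : regmx h phi).

(** The parameter [None] is the scalar of the cone, which accounts for one extra dimension. *)
Definition cone_h (t : option Th -> K) : K := t None * h (t \o some).
Definition cone_phi (t : option Th -> K) : pt K {set 'I_n} :=
  fun S => t None * minor (phi (t \o some)) S.

Lemma polyfun_cone_h : polyfun cone_h.
Proof.
apply: polyfun_mul; first exact: polyfun_coord.
by apply: (polyfun_comp ph) => th; apply: (polyfun_coord K (Some th)).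
Qed.

Lemma reg_cone_phi S : reg cone_h (fun t => cone_phi t S).
Proof.
have rm : reg h (fun t => minor (phi t) S).
  case: (boolP (#|S| == q)) => [/eqP cS|nS]; last first.
    by apply: reg_ext (reg_const h 0) => t _; rewrite /minor (negbTE nS).
  apply: (reg_ext (u := fun t => \det (colsub (ecol cS) (phi t)))) => [t _|].
    by rewrite minorE.
  apply: reg_det => // i j; apply: reg_ext (rphi i (ecol cS j)) => t _.
  by rewrite mxE.
have rm' : reg (fun t : option Th -> K => h (t \o some)) (fun t => minor (phi (t \o some)) S).
  by apply: (reg_pull (f := fun th t => t (Some th))) rm => th; apply: polyfun_coord.
have [N [L [pN eN]]] := rm'.
exists (fun t => t None * t None ^+ L * N t), L; split.
  apply: polyfun_mul => //; apply: polyfun_mul; first exact: polyfun_coord.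
  by apply: polyfun_exp; apply: polyfun_coord.
move=> t; rewrite mulf_eq0 negb_or => /andP[_ ht].
by rewrite /cone_phi /cone_h exprMn -(eN t ht); ring.
Qed.

End ConeChart.

Lemma dimle_cone m d Om : charted m d Om -> dimle d.+1 (cone Om).
Proof.
move=> [Th [J [h [phi [pos [cTh rphi _ _ cpl]]]]]].
have cO : #|{: option Th}| = d.+1 by rewrite card_option cTh.
pose S j := fun x => exists2 t, cone_h (h j) t != 0 & x = cone_phi (phi j) t.
apply: (@dimle_sub _ _ _ (fun x => exists j, S j x)).
  move=> x [l [Y [l0 /cpl[j [t [ht ->]]] ->]]]; exists j.
  exists (fun o => oapp t l o); first by rewrite mulf_neq0.
  by [].
apply: dimle_bigcup => j; rewrite -cO; have [pj rj] := rphi j.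
by apply: dimle_chart; [apply: polyfun_cone_h | move=> T; apply: reg_cone_phi].
Qed.

End Cone.

(** The chart through [Y0] gives the lower bound: its parameters are entries of a normalized matrix,
    hence quotients of Plücker coordinates by the scalar. *)
Lemma krull_dim_cone (K : numFieldType) (k n m d : nat) (Om : 'M[K]_(k.+1, n) -> Prop)
    (be : 'I_k.+1 -> 'I_n) (S : pt K {set 'I_n} -> Prop) (Y0 : 'M[K]_(k.+1, n)) :
  injective be -> (forall Y, Om Y -> colsub be Y = 1%:M) -> charted m d Om -> Om Y0 ->
  psubset (cone Om) S -> dimle d.+1 S -> krull_dim (zclosure S) d.+1.
Proof.
move=> beI norm [Th [J [h [phi [pos [cTh rphi _ snd cpl]]]]]] OY0 sub dS.
have cO : #|{: option Th}| = d.+1 by rewrite card_option cTh.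
have [j [t0 [ht0 _]]] := cpl _ OY0; have [pj rj] := rphi j.
rewrite -cO in dS *.
have [u pu uE] := scale_recover K beI.
apply: (@krull_dim_charts K _ _ (cone_h (h j)) (cone_phi (phi j)) S (fun o => oapp t0 1 o)) => //.
- exact: polyfun_cone_h.
- by move=> T; apply: reg_cone_phi.
- move=> t; rewrite mulf_eq0 negb_or => /andP[l0 ht]; apply: sub.
  by exists (t None), (phi j (t \o some)); split=> //; case: (snd j _ ht).
- by rewrite /cone_h mul1r.
- move=> [th|]; last first.
    exists u, (fun=> 1); split=> //; first exact: polyfun_const.
    move=> t; rewrite mulf_eq0 negb_or => /andP[l0 ht]; rewrite mulr1 oner_neq0.
    by split=> //; apply: uE; apply: norm; case: (snd j _ ht).
  have [w pw wE] := entry_recover K beI (pos j th).1 (pos j th).2.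
  exists w, u; split=> // t; rewrite mulf_eq0 negb_or => /andP[l0 ht].
  have [OY pE] := snd j _ ht; have Y1 := norm _ OY.
  by rewrite /cone_phi wE // uE // pE mulrC.
Qed.

Lemma normalize (K : fieldType) (k n : nat) (X : 'M[K]_(k.+1, n)) (be : 'I_k.+1 -> 'I_n) :
  injective be -> minor X (be @: setT) != 0 ->
  exists2 Y : 'M[K]_(k.+1, n), colsub be Y = 1%:M
    & exists l, [/\ l != 0, forall S, minor X S = l * minor Y S & \rank Y = \rank X].
Proof.
move=> beI; have [s ->] := minor_unsorted K beI.
rewrite mulf_eq0 signr_eq0 /= => d0; pose g := colsub be X.
have ug : g \in unitmx by rewrite unitmxE unitfE.
have XE : X = g *m (invmx g *m X) by rewrite mulKVmx.
exists (invmx g *m X).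
  apply/matrixP => i j; rewrite -[1%:M](mulVmx ug) !mxE.
  by apply: eq_bigr => l _; rewrite !mxE.
exists (\det g); split=> // [S|]; first by rewrite {1}XE minor_mulmx.
by rewrite (eqmxMfull X) // row_full_unit unitmx_inv.
Qed.

Lemma rank_normalized (K : fieldType) (q n : nat) (Y : 'M[K]_(q, n)) be :
  colsub be Y = 1%:M -> \rank Y = q.
Proof.
move=> Y1; apply/eqP; rewrite eqn_leq rank_leq_row /= -[X in (X <= _)%N](mxrank1 K q) -Y1.
have -> : colsub be Y = Y *m colsub be 1%:M.
  apply/matrixP => i j; rewrite !mxE (bigD1 (be j)) //= big1 ?addr0.
    by rewrite !mxE eqxx mulr1.
  by move=> l /negbTE lj; rewrite !mxE lj mulr0.
exact: mxrankM_maxl.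
Qed.

(** * Dimension of the Grassmannian cone *)

Section Grassmannian.
Variables (K : numFieldType) (k n : nat).
Notation q := k.+1.

Let cell (be : 'I_q -> 'I_n) (Y : 'M[K]_(q, n)) := colsub be Y = 1%:M.

Lemma charted_cell (be : 'I_q -> 'I_n) : injective be -> charted n (q * (n - q)) (cell be).
Proof.
move=> beI; pose b := be @: setT.
pose T := {x : 'I_q * 'I_n | x.2 \notin b}.
pose phi (t : T -> K) : 'M[K]_(q, n) :=
  \matrix_(a, j) if insub (a, j) is Some th then t th else (be a == j)%:R.
exists (T : finType), (unit : finType), (fun _ _ => 1), (fun _ => phi), (fun _ th => val th).
split.
- rewrite card_sig.
  have -> : #|[pred x : 'I_q * 'I_n | x.2 \notin b]| = #|setX [set: 'I_q] (~: b)|.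
    by apply: eq_card => -[a j]; rewrite !inE.
  rewrite cardsX cardsT card_ord; congr (_ * _)%N.
  by rewrite cardsCs setCK card_ord card_imset // cardsT card_ord.
- move=> _; split; first exact: polyfun_const.
  move=> a j; case: (insubP T (a, j)) => [th _ e|nb].
    apply: reg_ext (reg_poly _ (polyfun_coord K th)) => t _.
    by rewrite mxE -e valK.
  by apply: reg_ext (reg_const _ (be a == j)%:R) => t _; rewrite mxE insubN.
- by move=> _ th.
- move=> _ t _; split; last first.
    by move=> th; rewrite mxE -surjective_pairing valK.
  apply/matrixP => a i; rewrite !mxE insubN; last by rewrite negbK /b /= imset_f.
  by rewrite (inj_eq beI).
- move=> Y Y1; exists tt, (fun th => Y (val th).1 (val th).2); rewrite oner_neq0; split=> //.
  apply/matrixP => a j; rewrite mxE; case: insubP => [th _ -> //|].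
  rewrite negbK => /imsetP[i _ /= ->]; have /matrixP/(_ a i) := Y1.
  by rewrite !mxE (inj_eq beI).
Qed.

Lemma grass_coneE x : @grass_cone K q n x <->
  exists b : {b : {set 'I_n} | #|b| == q}, cone (cell (ecol (eqP (valP b)))) x.
Proof.
split=> [[X [rX ->]]|[b [l [Y [l0 Y1 ->]]]]].
  have [b [_ ib rb]] := basis_exists X^T setT.
  have cb : #|b| == q by rewrite -(eqP ib) rb rk_setT.
  exists (Sub b cb); set be := ecol _.
  have beI : injective be by apply: ecol_inj.
  have bE : be @: setT = b.
    apply/setP => j; apply/imsetP/idP => [[i _ ->]|jb]; first exact: ecol_in.
    have [i <-] := ecol_surj (eqP (valP (Sub b cb : {b : {set 'I_n} | #|b| == q}))) jb.
    by exists i.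
  have mb : minor X (be @: setT) != 0 by rewrite bE minor_basis // ib rb eqxx.
  have [Y Y1 [l [l0 XY _]]] := normalize beI mb.
  by exists l, Y; split=> //; apply/funext => S; apply: XY.
exists (lead k l *m Y); split; first by rewrite rank_lead // (rank_normalized Y1).
by apply/funext => S; rewrite /plucker minor_mulmx det_lead.
Qed.

Lemma krull_dim_grass : (q <= n)%N -> krull_dim (zclosure (@grass_cone K q n)) (q * (n - q)).+1.
Proof.
move=> qn; pose be : 'I_q -> 'I_n := widen_ord qn.
have beI : injective be by move=> i j /(congr1 val) /= /val_inj.
pose Y0 : 'M[K]_(q, n) := \matrix_(a, j) (be a == j)%:R.
have cY0 : cell be Y0 by apply/matrixP => a i; rewrite !mxE (inj_eq beI).
apply: (krull_dim_cone beI (Om := cell be) _ (charted_cell beI) cY0) => //.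
  move=> x [l [Y [l0 Y1 ->]]]; exists (lead k l *m Y).
  split; first by rewrite rank_lead // (rank_normalized Y1).
  by apply/funext => S; rewrite /plucker minor_mulmx det_lead.
pose J := {b : {set 'I_n} | #|b| == q}.
apply: (@dimle_sub _ _ _ (fun x => exists b : J, cone (cell (ecol (eqP (valP b)))) x)).
  by move=> x /grass_coneE.
by apply: dimle_bigcup => b; apply/dimle_cone/charted_cell/ecol_inj.
Qed.

End Grassmannian.

(** * Dimension of the cone over the stratum *)

Section Stratum.
Variables (F : realFieldType) (k n : nat) (A : 'M[F]_(k.+1, n)) (P : {set {set 'I_n}}).
Hypothesis A_ge0 : forall S : {set 'I_n}, #|S| = k.+1 -> 0 <= minor A S.
Hypothesis rA : \rank A = k.+1.
Hypothesis PA : forall S, (S \in P) = (minor A S != 0).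
Variable K : numFieldType.
Notation r := (mrk P).
Notation q := k.+1.

Lemma mrk_preS (j : 'I_n) : r (pre n j.+1) = (r (pre n j) + ~~ spans r j (pre n j))%N.
Proof. by rewrite preS (mrkU1 rA PA). Qed.

(** The prefix rank climbs from 0 to [q] in steps of at most one; [j] is where it first exceeds
    [a]. *)
Lemma pivot_exists (a : 'I_q) : exists j : 'I_n, ~~ spans r j (pre n j) /\ r (pre n j) = a.
Proof.
have ex : exists m, (a < r (pre n m))%N.
  exists n; have -> : pre n n = setT by apply/setP => j; rewrite !inE ltn_ord.
  by rewrite (mrk_rk rA PA) rk_setT.
have [[|m] lt min] := ex_minnP ex; first by rewrite pre0 mrk0 in lt.
have le : (r (pre n m) <= a)%N by rewrite leqNgt; apply/negP => /min; rewrite ltnn.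
have mn : (m < n)%N.
  rewrite ltnNge; apply/negP => nm; have e : pre n m.+1 = pre n m.
    by apply/setP => j; rewrite !inE !(leq_trans (ltn_ord j)) // ltnW.
  by rewrite e ltnNge le in lt.
exists (Ordinal mn); move: lt le; rewrite -[m.+1]/((Ordinal mn).+1) mrk_preS /=.
by case: (spans _ _ _) => /=; clear; lia.
Qed.

Lemma pivots_exist : exists be : 'I_q -> 'I_n, [/\ injective be,
  forall a, r (pre n (be a)) = a, forall a, ~~ spans r (be a) (pre n (be a))
  & forall j : 'I_n, ~~ spans r j (pre n j) -> exists a, j = be a].
Proof.
have [be beP] := choice pivot_exists; exists be.
have rbe a : r (pre n (be a)) = a by case: (beP a).
split=> //; first by move=> a a' e; apply/val_inj; rewrite /= -!rbe e.
  by move=> a; case: (beP a).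
move=> j nj; have lt : (r (pre n j) < q)%N.
  by apply: leq_trans (mrk_leq rA PA (pre n j.+1)); rewrite mrk_preS nj addn1.
exists (Ordinal lt); have [ns rj] := beP (Ordinal lt); rewrite /= in rj.
apply/val_inj; case: (ltngtP j (be (Ordinal lt))) => // lt'.
  have := mrk_mono rA PA (preS_sub n lt'); rewrite mrk_preS nj rj; clear; lia.
have := mrk_mono rA PA (preS_sub n lt'); rewrite mrk_preS ns rj; clear; lia.
Qed.

Lemma omega_stratum (Y : 'M[K]_(q, n)) : omega P n Y ->
  \rank Y = q /\ forall S, (minor Y S != 0) = (S \in P).
Proof.
move=> [_ Yr _ _]; have Yr' T : rk Y^T T = r T.
  by apply: Yr; apply/subsetP => j _; rewrite inE ltn_ord.
split; first by rewrite -mxrank_tr -(rsp_setT Y^T) -/(rk _ _) Yr' (mrk_rk rA PA) rk_setT.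
by move=> S; rewrite PA !minor_neq0 Yr' (mrk_rk rA PA).
Qed.

(** Nonpivot columns depend on earlier ones, so the pivots span all columns and can be made the
    identity; the zeros then propagate from left to right. *)
Lemma stratum_normalize (be : 'I_q -> 'I_n) (X : 'M[K]_(q, n)) : injective be ->
  (forall a, r (pre n (be a)) = a) -> (forall a, ~~ spans r (be a) (pre n (be a))) ->
  (forall j : 'I_n, ~~ spans r j (pre n j) -> exists a, j = be a) ->
  \rank X = q -> (forall S, (minor X S != 0) = (S \in P)) ->
  exists2 Y : 'M[K]_(q, n), omega P n Y & exists2 l, l != 0 & forall S, minor X S = l * minor Y S.
Proof.
move=> beI rbe nbe pbe rX XP.
have rE' (M : 'M[K]_(q, n)) T : \rank M = q -> (forall S, (minor M S != 0) = (S \in P)) ->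
    rk M^T T = r T.
  by move=> rM MP; apply/esym/mrkE.
have spE (M : 'M[K]_(q, n)) j T : \rank M = q -> (forall S, (minor M S != 0) = (S \in P)) ->
    spans r j T = (row j M^T <= rsp M^T T)%MS.
  by move=> rM MP; rewrite /spans -!(rE' M) // mem_rsp_rk.
have bX : minor X (be @: setT) != 0.
  rewrite minor_neq0 card_imset // cardsT card_ord eqxx /= eqn_leq rk_le /=.
  rewrite -[X in (X <= _)%N](rk_setT rX); apply: mxrankS; apply/rsp_subP => j _.
  have [m] := ubnP (j : nat); elim: m j => // m IH j ltj.
  case: (boolP (spans r j (pre n j))) => sj; last first.
    by have [a ->] := pbe j sj; rewrite row_rsp ?imset_f.
  move: sj; rewrite (spE X) // => /submx_trans; apply; apply/rsp_subP => i.
  by rewrite inE => ij; apply: IH; apply: leq_trans ij _.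
have [Y Y1 [l [l0 XY rY]]] := normalize beI bX.
have YP S : (minor Y S != 0) = (S \in P) by rewrite -XP XY mulf_eq0 negb_or l0.
rewrite rX in rY.
have Yp (j : 'I_n) (a : 'I_q) : ~~ spans r j (pre n j) -> Y a j = (a == r (pre n j) :> nat)%:R.
  move=> /pbe[i ->]; rewrite rbe; have /matrixP/(_ a i) := Y1.
  by rewrite !mxE.
exists Y; last by exists l.
split.
- by move=> j a; rewrite leqNgt ltn_ord.
- by move=> T _; apply: rE'.
- by move=> j a _; apply: Yp.
- move=> j a _; have [m] := ubnP (j : nat); elim: m j => // m IH j ltj.
  rewrite mrk_preS; case: (boolP (spans r j (pre n j))) => sj; last first.
    by rewrite addn1 => lt; rewrite Yp // gtn_eqF.
  rewrite addn0 => le; rewrite (spE Y) // in sj.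
  have := rsp_zero_coord (a := a) _ sj; rewrite !mxE; apply => i.
  rewrite inE => ij; apply: IH; first exact: leq_trans ij _.
  exact: leq_trans (mrk_mono rA PA (preS_sub n ij)) le.
Qed.

Lemma stratum_coneE x : @stratum_cone K q n P x <-> cone (@omega k n P K n) x.
Proof.
have [be [beI rbe nbe pbe]] := pivots_exist.
split=> [[X [rX -> XP]]|[l [Y [l0 OY ->]]]].
  have [Y OY [l l0 XY]] := stratum_normalize beI rbe nbe pbe rX XP.
  by exists l, Y; split=> //; apply/funext => S; apply: XY.
have [rY YP] := omega_stratum OY.
exists (lead k l *m Y); split; first exact: rank_lead.
  by apply/funext => S; rewrite /plucker minor_mulmx det_lead.
by move=> S; rewrite minor_mulmx det_lead mulf_eq0 negb_or l0 YP.
Qed.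

(** The point [X0] ensures that the stratum over [K], and so some chart, is nonempty. *)
Lemma krull_dim_stratum (X0 : 'M[K]_(q, n)) : \rank X0 = q ->
  (forall S, (minor X0 S != 0) = (S \in P)) ->
  exists2 d : nat, d%:Z = expdim P & krull_dim (zclosure (@stratum_cone K q n P)) d.+1.
Proof.
move=> rX0 X0P; have [be [beI rbe nbe pbe]] := pivots_exist.
have [d dE ch] := charted_omega A_ge0 rA PA K (leqnn n).
exists d; first by rewrite dE prefix_dimn.
have [Y0 OY0 _] := stratum_normalize beI rbe nbe pbe rX0 X0P.
apply: (krull_dim_cone beI _ ch OY0).
- move=> Y [_ _ Yp _]; apply/matrixP => a i; rewrite !mxE Yp ?nbe ?ltn_ord //.
  by rewrite rbe.
- by move=> x /stratum_coneE.
- apply: (@dimle_sub _ _ _ (cone (@omega k n P K n))); first by move=> x /stratum_coneE.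
  exact: dimle_cone ch.
Qed.

End Stratum.

Lemma minor_map (F K : fieldType) (f : {rmorphism F -> K}) k n (A : 'M[F]_(k, n)) S :
  minor (map_mx f A) S = f (minor A S).
Proof.
case: (boolP (#|S| == k)) => [/eqP cS|nS]; last by rewrite /minor (negbTE nS) rmorph0.
by rewrite !minorE -det_map_mx; congr (\det _); apply/matrixP => i j; rewrite !mxE.
Qed.

Lemma krull_dim_point (K : numFieldType) (I : finType) (S : pt K I -> Prop) x0 :
  (forall x, S x <-> x = x0) -> krull_dim (zclosure S) 0.
Proof.
move=> SE; have -> : 0%N = #|{: void}| by rewrite card_void.
have dS : dimle #|{: void}| S.
  apply: (@dimle_sub _ _ _ (fun x => exists2 t : void -> K, 1 != 0 :> K & x = x0)).
    by move=> x /SE ->; exists (of_void _); rewrite ?oner_neq0.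
  apply: (@dimle_chart K I void (fun=> 1) (fun=> x0)) => [|i]; first exact: polyfun_const.
  exact: reg_const.
apply: (@krull_dim_charts K I void (fun=> 1) (fun=> x0) S (of_void _)) => //.
- exact: polyfun_const.
- by move=> i; apply: reg_const.
- by move=> _ _; apply/SE.
- exact: oner_neq0.
Qed.

(* Over K = C = R[i] (R : realType). codim_{G(k,n)} X(P) is computed via
   affine cones in the Plücker embedding: dim G(k,n) = dG - 1 and
   dim X(P) = dX - 1, where dG, dX are the Krull dimensions of the Zariski
   closures of the cones. *)
Theorem theorem6p10 (R : realType) (k n : nat) (P : {set {set 'I_n}}) :
  is_positroid R k P ->
  exists dG dX : nat,
    [/\ krull_dim (zclosure (@grass_cone R[i] k n)) dG,
        krull_dim (zclosure (@stratum_cone R[i] k n P)) dX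
      & dG%:Z - dX%:Z = ec k P].
Proof.
move=> [A [rA A_ge0 PA]].
pose X0 : 'M[R[i]]_(k, n) := map_mx (real_complex R) A.
have rX0 : \rank X0 = k by rewrite mxrank_map.
have X0P S : (minor X0 S != 0) = (S \in P) by rewrite minor_map fmorph_eq0 PA.
(* In rank 0 there is only one matrix, so both cones are a single point of dimension 0. *)
case: k => [|k] in A rA A_ge0 PA X0 rX0 X0P *.
  have plE (X : 'M[R[i]]_(0, n)) : plucker X = plucker X0 by rewrite [X]flatmx0 [X0]flatmx0.
  exists 0%N, 0%N; split.
  - apply: (krull_dim_point (x0 := plucker X0)) => x; split=> [[X [_ ->]]|->]; first exact: plE.
    by exists X0.
  - apply: (krull_dim_point (x0 := plucker X0)) => x; split=> [[X [_ -> _]]|->]; first exact: plE.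
    by exists X0.
  - rewrite ecE mul0r sub0r /expdim big1 ?oppr0 // => S _.
    by rewrite (mrkE S rA PA) (eqP (_ : rk A^T S == 0)%N) ?mul0r // -leqn0 rk_le.
have kn : (k.+1 <= n)%N by rewrite -rA rank_leq_col.
have [d dE kd] := krull_dim_stratum A_ge0 rA PA rX0 X0P.
exists (k.+1 * (n - k.+1)).+1, d.+1; split=> //; first exact: krull_dim_grass.
rewrite ecE -dE (mrkE _ rA PA) rk_setT // (subzn kn) -PoszM.
by rewrite ![(_.+1)%:Z]intS opprD addrACA subrr add0r.
Qed.
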